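(* Let $\mathcal R=(R,<,+,0,\ldots)$ be a definably complete expansion of a densely linearly ordered abelian group. The following are equivalent: (1) Any definable closed subset of $R$ is either discrete or contains a nonempty open interval. (2) The open core of $\mathcal R$ is locally o-minimal. Furthermore, every set definable in the open core of $\mathcal R$ is constructible when one of (equivalently, both of) the conditions (1) and (2) is satisfied.
   Context: ''Definable'' means definable in the given structure with parameters. $R$ carries the order topology and $R^n$ the product topology. An open interval is a set of the form $\{x\in R \mid a<x<b\}$ with $a,b\in R$. An expansion $(R,<,\ldots)$ of a densely linearly ordered set without endpoints is definably complete if every definable subset of $R$ has a supremum and an infimum in $R\cup\{\pm\infty\}$. It is locally o-minimal if, for every definable subset $X$ of $R$ and every point $a\in R$, there exists an open interval $I$ containing $a$ such that $X\cap I$ is a finite union of points and open intervals. The open core of $\mathcal R$ is the reduct of $\mathcal R$ generated by its definable open sets, i.e. the structure with universe $R$ whose basic relations are all the open subsets of $R^n$ ($n\ge 1$) that are definable in $\mathcal R$. A set is constructible if it is a finite boolean combination of open sets. *)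

(* Defs.v *)
From HB Require Import structures.
From mathcomp Require Import all_boot all_order all_algebra.
From mathcomp Require Import all_classical topology.

Set Implicit Arguments.
Unset Strict Implicit.
Unset Printing Implicit Defensive.

Import Order.TTheory.

Local Open Scope classical_set_scope.
Local Open Scope ring_scope.

(** * Ordered abelian groups *)

(* The operation is a parameter because a class joining [zmodType] with the
   order classes would have to sit below [realDomainType] in the hierarchy. *)
Record ordered_abelian_group d (R : orderType d) (add : R -> R -> R)
    (zero : R) : Prop := OrderedAbelianGroup {
  oag_addA : associative add;
  oag_addC : commutative add;
  oag_add0 : left_id zero add;
  oag_addN : forall x, exists y, add y x = zero;
  oag_leD : forall x y z, (x <= y)%O -> (add z x <= add z y)%O
}.

Definition dense_order d (R : orderType d) : Prop :=
  forall x y : R, (x < y)%O -> exists z : R, (x < z < y)%O.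

Definition without_endpoints d (R : orderType d) : Prop :=
  forall x : R, exists y z : R, (y < x < z)%O.

(** * First-order logic *)

Record language : Type := Language {
  fsym : Type;
  farity : fsym -> nat;
  rsym : Type;
  rarity : rsym -> nat
}.

(* R^n is ['rV[R]_n], which carries the product topology. *)
Record structure (L : language) (R : Type) : Type := Structure {
  finterp : forall f : fsym L, 'rV[R]_(farity f) -> R;
  rinterp : forall r : rsym L, set 'rV[R]_(rarity r)
}.

Inductive term (L : language) : Type :=
| Var of nat
| App (f : fsym L) of ('I_(farity f) -> term L).

(* De Bruijn indices: [FEx] binds variable 0 and shifts the others. *)
Inductive formula (L : language) : Type :=
| FEq of term L & term L
| FRel (r : rsym L) of ('I_(rarity r) -> term L)
| FNeg of formula L
| FAnd of formula L & formula L
| FEx of formula L.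

Section Semantics.
Variables (L : language) (R : Type) (M : structure L R).

Fixpoint eval (v : nat -> R) (t : term L) : R :=
  match t with
  | Var i => v i
  | App f ts => finterp M (\row_i eval v (ts i))
  end.

Definition scons (a : R) (v : nat -> R) (i : nat) : R :=
  if i is j.+1 then v j else a.

Fixpoint sat (v : nat -> R) (phi : formula L) : Prop :=
  match phi with
  | FEq s t => eval v s = eval v t
  | FRel r ts => rinterp M (\row_i eval v (ts i))
  | FNeg p => ~ sat v p
  | FAnd p q => sat v p /\ sat v q
  | FEx p => exists a : R, sat (scons a v) p
  end.

(* x_0, ..., x_{n-1}, v_0, v_1, ... *)
Definition row_cat n (x : 'rV[R]_n) (v : nat -> R) (i : nat) : R :=
  if insub i is Some j then x ord0 j else v (i - n)%N.

(* Definability with parameters: the valuation [v] supplies the (finitely many)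
   parameters that [phi] mentions, through the variables of index at least n. *)
Definition definable n (X : set 'rV[R]_n) : Prop :=
  exists (phi : formula L) (v : nat -> R),
    X = [set x | sat (row_cat x v) phi].

Definition definable1 (X : set R) : Prop :=
  definable [set x : 'rV[R]_1 | X (x ord0 ord0)].

End Semantics.

(** * Expansions of ordered groups *)

Inductive ogroup_fsym : Type := AddSym | ZeroSym.

Definition ogroup_language : language := {|
  fsym := ogroup_fsym;
  farity := fun f => match f with AddSym => 2 | ZeroSym => 0 end;
  rsym := unit;
  rarity := fun=> 2
|}.

Definition ogroup_structure d (R : orderType d) (add : R -> R -> R)
    (zero : R) : structure ogroup_language R := {|
  finterp := fun f : fsym ogroup_language =>
    match f return 'rV[R]_(@farity ogroup_language f) -> R with
    | AddSym => fun x => add (x ord0 ord0) (x ord0 ord_max)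
    | ZeroSym => fun=> zero
    end;
  rinterp := fun _ : rsym ogroup_language =>
    [set x : 'rV[R]_2 | (x ord0 ord0 < x ord0 ord_max)%O]
|}.

Definition sum_language (L1 L2 : language) : language := {|
  fsym := fsym L1 + fsym L2;
  farity := fun f => match f with inl g => farity g | inr g => farity g end;
  rsym := rsym L1 + rsym L2;
  rarity := fun r => match r with inl s => rarity s | inr s => rarity s end
|}.

Definition sum_structure (L1 L2 : language) (R : Type)
    (M1 : structure L1 R) (M2 : structure L2 R) :
    structure (sum_language L1 L2) R := {|
  finterp := fun f : fsym (sum_language L1 L2) =>
    match f return 'rV[R]_(@farity (sum_language L1 L2) f) -> R with
    | inl g => @finterp L1 R M1 g
    | inr g => @finterp L2 R M2 g
    end;
  rinterp := fun r : rsym (sum_language L1 L2) =>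
    match r return set 'rV[R]_(@rarity (sum_language L1 L2) r) with
    | inl s => @rinterp L1 R M1 s
    | inr s => @rinterp L2 R M2 s
    end
|}.

(* The structure (R, <, +, 0, ...), where M interprets the dots. *)
Definition ogroup_expansion d (R : orderType d) (add : R -> R -> R) (zero : R)
    (L : language) (M : structure L R) :
    structure (sum_language ogroup_language L) R :=
  sum_structure (ogroup_structure add zero) M.

(** * The open core *)

Definition open_core_rsym (L : language) (R : topologicalType)
    (M : structure L R) : Type :=
  {n : nat & {U : set 'rV[R]_n | [/\ (0 < n)%N, open U & definable M U]}}.

Definition open_core_language (L : language) (R : topologicalType)
    (M : structure L R) : language := {|
  fsym := void;
  farity := fun=> 0;
  rsym := open_core_rsym M;
  rarity := fun U => projT1 U
|}.

Definition open_core (L : language) (R : topologicalType)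
    (M : structure L R) : structure (open_core_language M) R := {|
  finterp := fun f : fsym (open_core_language M) => match f with end;
  rinterp := fun U : rsym (open_core_language M) => sval (projT2 U)
|}.

(** * Definable completeness *)

(* R together with both infinities; the order on [\bar R] of the library is only
   available over a numDomainType. *)
Inductive ext (R : Type) : Type := NInfty | Fin of R | PInfty.
Arguments NInfty {R}.
Arguments PInfty {R}.

HB.instance Definition _ (R : Type) := gen_eqMixin (ext R).
HB.instance Definition _ (R : Type) := gen_choiceMixin (ext R).

Section ExtOrder.
Context d (R : orderType d).

Definition le_ext (x y : ext R) : bool :=
  match x, y with
  | NInfty, _ | _, PInfty => true
  | Fin a, Fin b => (a <= b)%O
  | _, _ => false
  end.

Lemma le_ext_refl : reflexive le_ext.
Proof. by case=> //= a; exact: lexx. Qed.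

Lemma le_ext_anti : antisymmetric le_ext.
Proof. by case=> [|a|] [|b|] //= /le_anti ->. Qed.

Lemma le_ext_trans : transitive le_ext.
Proof. by case=> [|b|] [|a|] [|c|] //=; exact: le_trans. Qed.

HB.instance Definition _ := Order.Le_isPOrder.Build d (ext R)
  le_ext_refl le_ext_anti le_ext_trans.

End ExtOrder.

Definition definably_complete d (R : orderType d) (L : language)
    (M : structure L R) : Prop :=
  forall X : set R, definable1 M X ->
    supremums (@Fin R @` X) !=set0 /\ infimums (@Fin R @` X) !=set0.

(** * Tameness conditions *)

Definition locally_ominimal d (R : orderType d) (L : language)
    (M : structure L R) : Prop :=
  forall (X : set R) (a : R), definable1 M X ->
    exists b c : R, (a \in `]b, c[) /\
      exists (P : set R) (J : set (R * R)),
        [/\ finite_set P, finite_set J &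
          X `&` `]b, c[%classic = P `|` \bigcup_(p in J) `]p.1, p.2[%classic].

Definition discrete_subset (T : topologicalType) (X : set T) : Prop :=
  X `<=` isolated X.

Definition closed_discrete_or_interval d (R : orderTopologicalType d)
    (L : language) (M : structure L R) : Prop :=
  forall X : set R, definable1 M X -> closed X ->
    discrete_subset X \/
    exists a b : R, `]a, b[%classic !=set0 /\ `]a, b[%classic `<=` X.

Inductive constructible (T : topologicalType) : set T -> Prop :=
| constructible_open U : open U -> constructible U
| constructibleC A : constructible A -> constructible (~` A)
| constructibleU A B :
    constructible A -> constructible B -> constructible (A `|` B).

(* Main.v *)
(* Call a subset of R^n D_Sigma if it is a union of closed bounded sets F(r, s),
   s > 0, definable uniformly in r and s, increasing in r and decreasing in s.
   Open and closed definable sets are D_Sigma, and D_Sigma sets are closed under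
   unions, intersections and projections. So it is enough to show, assuming (1),
   that every D_Sigma set is a boolean combination of definable open sets.

   Condition (1) yields a Baire category theorem: if the union of a definable
   chain of subsets of R^n is dense in a cube, then some member of the chain is
   dense in a subcube. For n = 1 this holds because the union of a definable
   chain of closed discrete sets is closed and discrete, and it is extended to
   all n by a Kuratowski-Ulam argument. Consequently a D_Sigma set without
   interior is nowhere dense. The dimension of a D_Sigma set A is the largest d
   such that a coordinate projection of A to R^d has interior; selecting
   generically continuous sections of A over such a projection, one finds that
   the set of the points at which A is not locally closed has smaller dimension
   than A, and one concludes by induction on the dimension. *)

From mathcomp Require Import all_boot all_order all_algebra.
From mathcomp Require Import all_classical topology.
Require Import Defs.

Set Implicit Arguments.
Unset Strict Implicit.
Unset Printing Implicit Defensive.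

Import Order.TTheory.

Local Open Scope classical_set_scope.

(** * Definability *)

(** Two obstacles shape the proof. Projections preserve closedness only for bounded sets, and the
    complement of a [sigma] set is not visibly [sigma]. The first is why the families carry a bound
    [r]: projections are then controlled by [interval_compact], where definable completeness
    replaces compactness, while [s] exhausts an open set by closed ones. The second is overcome by
    [sigma_definably_constructible], since boolean combinations of definable open sets do have
    [sigma] complements. Induction on formulas of the open core thus treats negation for free and an
    existential quantifier by projecting a [sigma] family. Continuous sections are obtained by
    taking the least value of one coordinate at a time; Baire category makes it continuous over a
    subcube. Local o-minimality follows because the boundary of a set definable in the open core is
    nowhere dense in the line, hence by (1) has no accumulation point. Conversely, a closed
    definable set is the complement of a basic relation of the open core, so (2) applies to it
    directly. *)

Section Substitution.
Variables (L : language) (R : Type) (M : structure L R).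

Fixpoint term_subst (s : nat -> term L) (t : term L) : term L :=
  match t with
  | Var i => s i
  | App f ts => App (fun i => term_subst s (ts i))
  end.

Definition subst_up (s : nat -> term L) (i : nat) : term L :=
  if i is j.+1 then term_subst (fun k => Var L k.+1) (s j) else Var L 0.

Fixpoint formula_subst (s : nat -> term L) (phi : formula L) : formula L :=
  match phi with
  | FEq t u => FEq (term_subst s t) (term_subst s u)
  | FRel r ts => FRel (fun i => term_subst s (ts i))
  | FNeg p => FNeg (formula_subst s p)
  | FAnd p q => FAnd (formula_subst s p) (formula_subst s q)
  | FEx p => FEx (formula_subst (subst_up s) p)
  end.

Lemma eval_subst s t v :
  eval M v (term_subst s t) = eval M (fun i => eval M v (s i)) t.
Proof.
by elim: t => //= f ts IH; congr finterp; apply/rowP => i; rewrite !mxE IH.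
Qed.

Lemma sat_subst s phi v :
  sat M v (formula_subst s phi) <-> sat M (fun i => eval M v (s i)) phi.
Proof.
elim: phi s v => [t u|r ts|p IH|p IHp q IHq|p IH] s v /=.
- by rewrite !eval_subst.
- by under eq_mx do rewrite eval_subst.
- by rewrite IH.
- by rewrite IHp IHq.
- have E a : (fun i => eval M (scons a v) (subst_up s i)) =
      scons a (fun i => eval M v (s i)).
    by apply/funext => -[|i] //=; rewrite eval_subst.
  by split=> -[a]; [rewrite IH E | rewrite -E -IH] => H; exists a.
Qed.

End Substitution.

(* An environment is a type of tuples of elements of R, given by its
   coordinate functions. *)
Class env (R E : Type) : Type := coord : set (E -> R).

Instance env_point (R : Type) : env R R := [set f : R -> R | f = id].
Instance env_row (R : Type) n : env R 'rV[R]_n :=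
  [set f : 'rV[R]_n -> R | exists i, f = fun x => x ord0 i].
Instance env_pair (R E F : Type) (cE : env R E) (cF : env R F) :
    env R (E * F) :=
  [set f : E * F -> R | (exists2 c, cE c & f = c \o fst) \/ (exists2 c, cF c &
    f = c \o snd)].

Section Definability.
Variables (L : language) (R : Type) (M : structure L R) (r0 : R).

Definition basic_map E (cE : env R E) (f : E -> R) : Prop :=
  cE f \/ exists c, f = fun=> c.

(** Being closed under composition, term maps let a definable predicate be pulled back along an
    [env_map] with the same formula and only another valuation. *)
Definition term_map E {cE : env R E} (f : E -> R) : Prop :=
  exists (t : term L) (g : nat -> E -> R),
    (forall i, basic_map cE (g i)) /\ forall e, f e = eval M (g^~ e) t.

Definition env_map E F {cE : env R E} {cF : env R F} (h : E -> F) : Prop :=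
  forall c, coord c -> term_map (c \o h).

Definition definable_on E {cE : env R E} (P : E -> Prop) : Prop :=
  exists (phi : formula L) (g : nat -> E -> R),
    (forall i, term_map (g i)) /\ forall e, P e <-> sat M (g^~ e) phi.

Section Env.
Context {E : Type} {cE : env R E}.

Lemma basic_term_map (f : E -> R) : basic_map cE f -> term_map f.
Proof. by move=> cf; exists (Var L 0), (fun=> f). Qed.

Lemma term_map_cst (c : R) : term_map (fun _ : E => c).
Proof. by apply: basic_term_map; right; exists c. Qed.

(** Each term comes with its own valuation; coding variable [j] of term [i] as [pickle (i, j)] puts
    all of them over a common one. The default of [unpickle] is never read by a term. *)
Lemma term_map_seq (f : nat -> E -> R) : (forall i, term_map (f i)) ->
  exists (t : nat -> term L) (g : nat -> E -> R),
    (forall i, basic_map cE (g i)) /\ forall i e, f i e = eval M (g^~ e) (t i).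
Proof.
move=> /choice[t /choice[g gP]].
pose k m : nat * nat := odflt (0, 0) (unpickle m).
exists (fun i => term_subst (fun j => Var L (pickle (i, j))) (t i)).
exists (fun m => g (k m).1 (k m).2); split=> [m|i e].
  exact: (gP _).1.
rewrite eval_subst (gP i).2; congr eval; apply/funext => j /=.
by rewrite /k pickleK.
Qed.

Lemma term_map_eval (f : nat -> E -> R) (t : term L) :
  (forall i, term_map (f i)) -> term_map (fun e => eval M (f^~ e) t).
Proof.
move=> /term_map_seq[u [g [cg fg]]].
exists (term_subst u t), g; split=> // e.
by rewrite eval_subst; congr eval; apply/funext.
Qed.

Lemma term_map_comp F (cF : env R F) (f : F -> R) (h : E -> F) :
  term_map f -> env_map h -> term_map (fun e => f (h e)).
Proof.
move=> [t [g [cg fE]]] mh.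
have -> : (fun e => f (h e)) = fun e => eval M ((fun i => g i \o h)^~ e) t.
  by apply/funext => e; rewrite fE.
apply: term_map_eval => i; have [gi|[c ->]] := cg i; first exact: mh.
exact: term_map_cst.
Qed.

Lemma env_map_id : env_map (fun e : E => e).
Proof. by move=> c cc; apply: basic_term_map; left. Qed.

Lemma env_map_fst F G {cF : env R F} {cG : env R G} (h : E -> F * G) :
  env_map h -> env_map (fun e => (h e).1).
Proof. by move=> mh c cc; apply: (mh (c \o fst)); left; exists c. Qed.

Lemma env_map_snd F G {cF : env R F} {cG : env R G} (h : E -> F * G) :
  env_map h -> env_map (fun e => (h e).2).
Proof. by move=> mh c cc; apply: (mh (c \o snd)); right; exists c. Qed.

Lemma env_map_pair F G {cF : env R F} {cG : env R G} (h : E -> F) (k : E -> G) :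
  env_map h -> env_map k -> env_map (fun e => (h e, k e)).
Proof. by move=> mh mk c [[c' cc ->]|[c' cc ->]]; [exact: mh|exact: mk]. Qed.

Lemma term_env_map (h : E -> R) : term_map h -> env_map h.
Proof. by move=> mh c ->. Qed.

Lemma env_term_map (h : E -> R) : env_map h -> term_map h.
Proof. by move=> mh; exact: (mh id). Qed.

Lemma env_map_cst (c : R) : env_map (fun _ : E => c).
Proof. exact/term_env_map/term_map_cst. Qed.

Lemma env_map_cst_row n (x : 'rV[R]_n) : env_map (fun _ : E => x).
Proof. by move=> c [i ->]; exact: term_map_cst. Qed.

Lemma env_map_coord n (h : E -> 'rV[R]_n) i :
  env_map h -> env_map (fun e => h e ord0 i).
Proof. by move=> mh; apply: term_env_map; apply: (mh (fun x => x ord0 i));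
  exists i. Qed.

Lemma env_map_row n (f : E -> 'I_n -> R) :
  (forall i, env_map (fun e => f e i)) -> env_map (fun e => \row_i f e i)%R.
Proof.
move=> mf _ [i ->]; rewrite /comp; under eq_fun do rewrite mxE.
exact/env_term_map/mf.
Qed.

Lemma definable_ext (P Q : E -> Prop) :
  (forall e, P e <-> Q e) -> definable_on P -> definable_on Q.
Proof.
by move=> PQ [phi [g [mg Pg]]]; exists phi, g; split=> // e; rewrite -PQ.
Qed.

Lemma definable_comp F (cF : env R F) (P : F -> Prop) (h : E -> F) :
  definable_on P -> env_map h -> definable_on (fun e => P (h e)).
Proof.
move=> [phi [g [mg Pg]]] mh; exists phi, (fun i e => g i (h e)); split=> // i.
exact: term_map_comp.
Qed.

Lemma definable_eq (f g : E -> R) :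
  env_map f -> env_map g -> definable_on (fun e => f e = g e).
Proof.
move=> mf mg; exists (FEq (Var L 0) (Var L 1)), (fun i =>
  if i is 0 then f else g).
by split=> [[|i]|e] //; exact: env_term_map.
Qed.

Lemma definable_not (P : E -> Prop) :
  definable_on P -> definable_on (fun e => ~ P e).
Proof.
by move=> [phi [g [mg Pg]]]; exists (FNeg phi), g; split=> // e /=; rewrite Pg.
Qed.

Lemma definable_and (P Q : E -> Prop) :
  definable_on P -> definable_on Q -> definable_on (fun e => P e /\ Q e).
Proof.
move=> [phi [g [mg Pg]]] [psi [h [mh Qh]]].
(* Even variables serve [phi] and odd ones [psi], so the two valuations coexist. *)
exists (FAnd (formula_subst (fun i => Var L i.*2) phi)
             (formula_subst (fun i => Var L i.*2.+1) psi)).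
exists (fun i => if odd i then h i./2 else g i./2); split=> [i|e /=].
  by case: ifP.
rewrite !sat_subst Pg Qh.
have -> : (fun i => eval M (fun j => (if odd j then h j./2 else g j./2) e)
    (Var L i.*2)) = g^~ e by apply/funext => i /=; rewrite odd_double doubleK.
have -> : (fun i => eval M (fun j => (if odd j then h j./2 else g j./2) e)
    (Var L i.*2.+1)) = h^~ e.
  by apply/funext => i /=; rewrite odd_double /= uphalf_double.
by [].
Qed.

Lemma definable_or (P Q : E -> Prop) :
  definable_on P -> definable_on Q -> definable_on (fun e => P e \/ Q e).
Proof.
move=> dP dQ; apply: (@definable_ext (fun e => ~ (~ P e /\ ~ Q e))) => [e|].
  by rewrite not_andE !notK.
exact/definable_not/definable_and/definable_not/dQ/definable_not.
Qed.

Lemma definable_imply (P Q : E -> Prop) :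
  definable_on P -> definable_on Q -> definable_on (fun e => P e -> Q e).
Proof.
move=> dP dQ; apply: (@definable_ext (fun e => ~ P e \/ Q e)) => [e|].
  split=> [[nP /nP|q _]|PQ] //.
  by have [p|np] := pselect (P e); [right; exact: PQ|left].
exact/definable_or/dQ/definable_not.
Qed.

Lemma definable_cst (A : Prop) : definable_on (fun _ : E => A).
Proof.
have dT : definable_on (fun _ : E => r0 = r0).
  by apply: definable_eq; exact: env_map_cst.
have [a|na] := pselect A; first exact: definable_ext dT.
by apply: definable_ext (definable_not dT).
Qed.

Lemma definable_all_fin (I : finType) (P : I -> E -> Prop) :
  (forall i, definable_on (P i)) -> definable_on (fun e => forall i, P i e).
Proof.
move=> dP.
suff /(_ (enum I)): forall s : seq I,
    @definable_on E cE (fun e => forall i, i \in s -> P i e).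
  by apply: definable_ext => e; split=> // H i; apply: H; rewrite mem_enum.
elim=> [|i s IH]; first exact: definable_ext (definable_cst True).
apply: definable_ext (definable_and (dP i) IH) => e; split=> [[Pi Ps] j|H].
  by rewrite inE => /orP[/eqP ->|/Ps].
by split=> [|j js]; apply: H; rewrite inE ?eqxx ?js ?orbT.
Qed.

End Env.

Lemma definable_ex E (cE : env R E) (P : E -> R -> Prop) :
  definable_on (fun q : E * R => P q.1 q.2) ->
  definable_on (fun e => exists a, P e a).
Proof.
move=> [phi [g [/term_map_seq[t [w [cw gE]]] Pg]]].
(* The three cases are a coordinate of [e], the quantified coordinate and a constant. The quantified
   one becomes [Var L 0]; its slot in the outer valuation gets the dummy value [r0]. *)
have /choice[rho /choice[v vP]] j : exists (rj : term L) (vj : E -> R),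
    basic_map cE vj /\
    forall e a (u : nat -> R), u j = vj e ->
      w j (e, a) = eval M (scons a u) rj.
  have [[[c cc ->]|[c -> ->]]|[c ->]] := cw j.
  - by exists (Var L j.+1), c; split=> [|e a u /= ->] //; left.
  - by exists (Var L 0), (fun=> r0); split=> //; right; exists r0.
  - by exists (Var L j.+1), (fun=> c); split=> [|e a u /= ->] //; right;
    exists c.
exists (FEx (formula_subst (fun i => term_subst rho (t i)) phi)), v.
split=> [i|e /=]; first exact/basic_term_map/(vP i).1.
have aux a : sat M (scons a (v^~ e))
    (formula_subst (fun i => term_subst rho (t i)) phi) <-> P e a.
  rewrite sat_subst -[P e a]/(P (e, a).1 (e, a).2) Pg.
  suff -> : (fun i => eval M (scons a (v^~ e)) (term_subst rho (t i))) =
    g^~ (e, a) by [].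
  apply/funext => i; rewrite eval_subst gE; congr eval; apply/funext => j.
  by rewrite ((vP j).2 e a (v^~ e)).
by split=> -[a /aux Pa]; exists a.
Qed.

Lemma definable_all E (cE : env R E) (P : E -> R -> Prop) :
  definable_on (fun q : E * R => P q.1 q.2) ->
  definable_on (fun e => forall a, P e a).
Proof.
move=> dP; apply: (@definable_ext _ _ (fun e => ~ exists a, ~ P e a)) => [e|].
  by split=> [H a|H [a]]; [apply: contrapT => nP; apply: H; exists a|exact].
exact/definable_not/definable_ex/definable_not.
Qed.

Lemma definable_ex_row n E (cE : env R E) (P : E -> 'rV[R]_n -> Prop) :
  definable_on (fun q : E * 'rV[R]_n => P q.1 q.2) ->
  definable_on (fun e => exists x, P e x).
Proof.
elim: n E cE P => [|n IH] E cE P dP.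
  pose x0 : 'rV[R]_0 := (\row_i r0)%R.
  apply: (@definable_ext _ _ (fun e => P e x0)) => [e|].
    by split=> [|[x]]; [exists x0|rewrite (_ : x = x0) //; apply/rowP; case].
  apply: (definable_comp (h := fun e => (e, x0)) dP).
  by apply: env_map_pair; [exact: env_map_id|exact: env_map_cst_row].
pose cons (x : 'rV[R]_n) a : 'rV[R]_n.+1 :=
  (\row_i if unlift ord0 i is Some j then x ord0 j else a)%R.
apply: (@definable_ext _ _ (fun e => exists a x, P e (cons x a))) => [e|].
  split=> [[a [x]]|[x Px]]; first by exists (cons x a).
  exists (x ord0 ord0), (\row_j x ord0 (lift ord0 j))%R.
  rewrite (_ : cons _ _ = x) //; apply/rowP => i; rewrite !mxE.
  by case: unliftP => [j|] ->; rewrite ?mxE.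
apply: definable_ex.
apply: (IH _ _ (fun (q : E * R) x => P q.1 (cons x q.2))).
apply: (definable_comp (h := fun q : E * R * 'rV[R]_n =>
  (q.1.1, cons q.2 q.1.2)) dP).
apply: env_map_pair; first exact/env_map_fst/env_map_fst/env_map_id.
apply: env_map_row => i; case: unliftP => [j|] _.
  exact/env_map_coord/env_map_snd/env_map_id.
exact/env_map_snd/env_map_fst/env_map_id.
Qed.

Lemma definable_all_row n E (cE : env R E) (P : E -> 'rV[R]_n -> Prop) :
  definable_on (fun q : E * 'rV[R]_n => P q.1 q.2) ->
  definable_on (fun e => forall x, P e x).
Proof.
move=> dP; apply: (@definable_ext _ _ (fun e => ~ exists x, ~ P e x)) => [e|].
  by split=> [H a|H [a]]; [apply: contrapT => nP; apply: H; exists a|exact].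
exact/definable_not/definable_ex_row/definable_not.
Qed.

Lemma definable_onE n (X : set 'rV[R]_n) : definable M X <-> definable_on X.
Proof.
split=> [[phi [v ->]]|[phi [g [/term_map_seq[t [w [cw gE]]] Xg]]]].
  exists phi, (fun i x => row_cat x v i); split=> // i.
  apply: basic_term_map; rewrite /row_cat; case: insubP => [j _ _|_].
    by left; exists j.
  by right; exists (v (i - n)).
(* A coordinate keeps its index, while a constant at place [j] becomes the parameter variable
   [n + j], which [row_cat] reads in [v]. *)
have /choice[rho /choice[v vP]] j : exists (rj : nat) (a : R),
    forall x u, u j = a -> w j x = row_cat x u rj.
  have [[i ->]|[c ->]] := cw j.
    exists i, r0 => x u _; rewrite /row_cat insubT //= => ?.
    by congr (x _ _); apply: val_inj.
  exists (n + j), c => x u <-; rewrite /row_cat insubN -?leqNgt ?leq_addr //.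
  by rewrite addKn.
exists (formula_subst (fun i => term_subst (fun j =>
  Var L (rho j)) (t i)) phi), v.
apply/seteqP; split=> x /=; rewrite sat_subst Xg;
  suff -> : (fun i => eval M (row_cat x v) (term_subst (fun j =>
    Var L (rho j)) (t i))) =
    g^~ x by [].
all: by apply/funext => i; rewrite eval_subst gE; congr eval; apply/funext => j;
  rewrite (vP j x v).
Qed.

End Definability.

Local Open Scope order_scope.
(** * Ordered abelian groups *)

Section OrderedGroup.
Variables (d : Order.disp_t) (R : orderTopologicalType d).
Variables (add : R -> R -> R) (zero : R).
Hypothesis R_group : ordered_abelian_group add zero.
Hypothesis R_dense : dense_order R.
Hypothesis R_noends : without_endpoints R.

Local Notation "x [+] y" := (add x y) (at level 50, left associativity).

Let addA := oag_addA R_group.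
Let addC := oag_addC R_group.
Let add0 := oag_add0 R_group.

Lemma addr0 x : x [+] zero = x. Proof. by rewrite addC add0. Qed.

Lemma opp_ex x : exists y, x [+] y = zero.
Proof. by have [y yx] := oag_addN R_group x; exists y; rewrite addC. Qed.

Lemma sub_ex x y : exists z, x [+] z = y.
Proof.
by have [x' xx'] := opp_ex x; exists (x' [+] y); rewrite addA xx' add0.
Qed.

Lemma add_inj z : injective (add z).
Proof.
move=> x y /(congr1 (add (sval (cid (opp_ex z))))); case: cid => z' zz' /=.
by rewrite !addA ![z' [+] z]addC zz' !add0.
Qed.

Lemma ltD2l z x y : x < y -> z [+] x < z [+] y.
Proof.
rewrite !lt_neqAle => /andP[xy /(oag_leD R_group) ->]; rewrite andbT.
by apply: contra xy => /eqP /add_inj ->.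
Qed.

Lemma leD2lE z x y : (z [+] x <= z [+] y) = (x <= y).
Proof.
apply/idP/idP; last exact: (oag_leD R_group).
by rewrite leNgt => zxy; rewrite leNgt; apply: contra zxy; exact: ltD2l.
Qed.

Lemma ltD2lE z x y : (z [+] x < z [+] y) = (x < y).
Proof. by rewrite !ltNge leD2lE. Qed.

Lemma leD2rE z x y : (x [+] z <= y [+] z) = (x <= y).
Proof. by rewrite ![_ [+] z]addC leD2lE. Qed.

Lemma ltD2rE z x y : (x [+] z < y [+] z) = (x < y).
Proof. by rewrite !ltNge leD2rE. Qed.

Lemma lt_addr x e : (x < x [+] e) = (zero < e).
Proof. by rewrite -{1}(addr0 x) ltD2lE. Qed.

Lemma pos_ex : exists e, zero < e.
Proof. by have [_ [e /andP[_ e0]]] := R_noends zero; exists e. Qed.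

(** Divisibility is not assumed. Density gives [h] between [zero] and [e]; if [h [+] h] exceeds [e],
    the difference of [e] and [h] is smaller than [h] and serves instead. *)
Lemma half_ex e : zero < e -> exists2 h, zero < h & h [+] h <= e.
Proof.
move=> /R_dense[h /andP[h0 he]]; have [hh|hh] := leP (h [+] h) e.
  by exists h.
have [r hr] := sub_ex h e; exists r; first by rewrite -(lt_addr h) hr.
by rewrite -hr leD2rE -(leD2lE h) hr ltW.
Qed.

(* [near e x y] says |x - y| < e, and [nearc e x y] that |x - y| <= e. *)
Definition near e x y : Prop := (x < y [+] e) /\ (y < x [+] e).
Definition nearc e x y : Prop := (x <= y [+] e) /\ (y <= x [+] e).

Lemma near_refl e x : zero < e -> near e x x.
Proof. by rewrite /near lt_addr. Qed.

Lemma near_sym e x y : near e x y -> near e y x.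
Proof. by case. Qed.

Lemma near_le e e' x y : e <= e' -> near e x y -> near e' x y.
Proof. by move=> ee' [h k]; split;
  [apply: lt_le_trans h _|apply: lt_le_trans k _]; rewrite leD2lE. Qed.

Lemma near_nearc e x y : near e x y -> nearc e x y.
Proof. by move=> [/ltW ? /ltW ?]. Qed.

Lemma nearc_near e e' x y : e < e' -> nearc e x y -> near e' x y.
Proof. by move=> ee' [h k]; split;
  [apply: le_lt_trans h _|apply: le_lt_trans k _]; rewrite ltD2lE. Qed.

Lemma near_trans y e e' x z : near e x y -> near e' y z -> near (e [+] e') x z.
Proof.
move=> [xy yx] [yz zy]; split.
  by apply: lt_trans xy _; rewrite (addC e) addA ltD2rE.
by apply: lt_trans zy _; rewrite addA ltD2rE.
Qed.

Lemma near_itv p x q : p < x -> x < q ->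
  exists2 e, zero < e & forall y, near e x y -> (p < y) /\ (y < q).
Proof.
move=> px xq; have [e1 e1E] := sub_ex p x; have [e2 e2E] := sub_ex x q.
exists (Order.min e1 e2) => [|y /[dup]].
  by rewrite lt_min -(lt_addr p) -(lt_addr x) e1E e2E px.
have [/near_le le1 /near_le le2] :
  Order.min e1 e2 <= e1 /\ Order.min e1 e2 <= e2.
  by rewrite !ge_min !lexx orbT.
by move=> /le1[+ _] /le2[_ +]; rewrite -{1}e1E e2E ltD2rE.
Qed.

Lemma nearE e : exists e', forall x y,
  near e x y <-> (x [+] e' < y) /\ (y < x [+] e).
Proof.
have [e' ee'] := opp_ex e; exists e' => x y.
by rewrite -(ltD2rE e) -addA (addC e') ee' addr0.
Qed.

Lemma near_open e x y : near e x y ->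
  exists2 h, zero < h & forall y', near h y y' -> near e x y'.
Proof.
have [e' eE] := nearE e; move=> /eE[/near_itv h /h[k k0 kP]].
by exists k => // y' /kP /eE.
Qed.

Lemma nearc_closed e x y : ~ nearc e x y ->
  exists2 h, zero < h & forall x' y', near h x x' -> near h y y' ->
    ~ nearc e x' y'.
Proof.
wlog yx : x y / y [+] e < x => [hw|_].
  rewrite /nearc => /not_andP nE.
  have [yx|] := ltP (y [+] e) x; first by apply: hw => //; case;
    rewrite leNgt yx.
  case: nE => [/negP/negbTE -> //|/negP]; rewrite -ltNge => xy _.
  have [|h h0 hP] := hw y x xy; first by case; rewrite leNgt xy.
  by exists h => // x' y' xx' yy' [? ?]; apply: (hP y' x').
have [e1 e1E] := sub_ex (y [+] e) x.
have e10 : zero < e1 by rewrite -(lt_addr (y [+] e)) e1E.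
have [h h0 hh] := half_ex e10; exists h => // x' y' [+ _] [_ +] [+ _].
rewrite -e1E => h1 h2 h3.
suff : y [+] e [+] e1 < y [+] e [+] e1 by rewrite ltxx.
apply: lt_le_trans h1 _; apply: le_trans (_ : y' [+] e [+] h <= _).
  by rewrite leD2rE.
apply: le_trans (_ : y [+] h [+] e [+] h <= _).
  by rewrite !leD2rE ltW.
by rewrite -(addA y) (addC h) addA -addA leD2lE.
Qed.

Lemma near_between e a b x y :
  near e a b -> a <= x -> a <= y -> x <= b -> y <= b -> near e x y.
Proof.
move=> [_ ba] ax ay xb yb; split.
  by apply: le_lt_trans xb (lt_le_trans ba _); rewrite leD2rE.
by apply: le_lt_trans yb (lt_le_trans ba _); rewrite leD2rE.
Qed.

Lemma near_eq x y : (forall e, zero < e -> near e x y) -> x = y.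
Proof.
move=> xy; wlog ltxy : x y xy / x < y => [hw|].
  have [/hw -> //|/hw -> // e /xy[]|->] := ltgtP x y => //.
have [e eE] := sub_ex x y; have /xy[_] : zero < e by rewrite -(lt_addr x) eE.
by rewrite eE ltxx.
Qed.

Lemma near_above x v e : x < v -> zero < e ->
  exists y, [/\ x < y, y < v & near e x y].
Proof.
move=> xv e0; have : x < Order.min v (x [+] e) by rewrite lt_min xv lt_addr.
move=> /R_dense[y]; rewrite lt_min => /and3P[xy yv ye]; exists y; split=> //.
by split=> //; apply: lt_trans xy _; rewrite lt_addr.
Qed.

Lemma near_below x u e : u < x -> zero < e ->
  exists y, [/\ u < y, y < x & near e x y].
Proof.
move=> ux e0; have [x' x'E] := sub_ex e x.
have x'x : x' < x by rewrite -x'E addC lt_addr.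
have : Order.max u x' < x by rewrite gt_max ux.
move=> /R_dense[y]; rewrite gt_max => /andP[/andP[uy x'y] yx]; exists y;
  split=> //.
split; first by rewrite -x'E addC ltD2rE.
by apply: lt_trans yx _; rewrite lt_addr.
Qed.

Lemma min_pos (a b : R) : zero < a -> zero < b ->
  [/\ zero < Order.min a b, Order.min a b <= a & Order.min a b <= b].
Proof. by move=> a0 b0; rewrite lt_min a0 b0 !ge_min !lexx orbT. Qed.

Lemma fin_pos (I : finType) (P : I -> R -> Prop) :
  (forall i e e', e' <= e -> P i e -> P i e') ->
  (forall i, exists2 e, zero < e & P i e) ->
  exists2 e, zero < e & forall i, P i e.
Proof.
move=> Pd Pe.
suff [e e0 eP] : exists2 e, zero < e & forall i, i \in enum I -> P i e.
  by exists e => // i; apply: eP; rewrite mem_enum.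
elim: (enum I) => [|i s [e e0 IH]]; first by have [e] := pos_ex; exists e.
have [e' e'0 ie'] := Pe i; have [m0 me me'] := min_pos e0 e'0.
exists (Order.min e e') => // j; rewrite inE => /orP[/eqP ->|/IH].
  exact: Pd ie'.
exact: Pd.
Qed.

(** * Definability and neighbourhoods in an expansion of the group *)

Section Definability.
Variables (L : language) (M : structure L R).
Local Notation N := (ogroup_expansion add zero M).
Local Notation emap := (env_map N).
Local Notation dfn := (definable_on N).

Section Env.
Context {E : Type} {cE : env R E}.
Implicit Types f g h : E -> R.

Lemma env_map_add f g : emap f -> emap g -> emap (fun p => f p [+] g p).
Proof.
move=> /env_term_map mf /env_term_map mg; apply: term_env_map.
pose t : term (sum_language ogroup_language L) :=
  @App (sum_language ogroup_language L) (inl AddSym) (fun i => Var _ (val i)).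
have -> : (fun p => f p [+] g p) =
    fun p => Defs.eval N ((fun i => if i is 0%N then f else g)^~ p) t.
  by apply/funext => p /=; rewrite !mxE.
by apply: term_map_eval => -[|i].
Qed.

Lemma definable_lt f g :
  emap f -> emap g -> dfn (fun p => f p < g p).
Proof.
move=> mf mg; exists (@FRel (sum_language ogroup_language L) (inl tt)
  (fun i => Var _ (val i))), (fun i => if i is 0%N then f else g).
by split=> [[|i]|p /=]; [exact: env_term_map..|rewrite !mxE].
Qed.

Lemma definable_le f g :
  emap f -> emap g -> dfn (fun p => f p <= g p).
Proof.
move=> mf mg; apply: (@definable_ext _ _ _ _ _ (fun p => ~ g p < f p)) => [p|].
  by rewrite leNgt; split=> /negP.
exact/definable_not/definable_lt.
Qed.

Lemma definable_and3 (P Q T : E -> Prop) :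
  dfn P -> dfn Q -> dfn T -> dfn (fun p => [/\ P p, Q p & T p]).
Proof.
move=> dP dQ dT.
apply: definable_ext (definable_and dP (definable_and dQ dT)) => p.
by split=> [[? []]|[]].
Qed.

Lemma definable_near h f g : emap h -> emap f -> emap g ->
  dfn (fun p => near (h p) (f p) (g p)).
Proof.
by move=> mh mf mg; apply: definable_and; apply: definable_lt => //;
  exact: env_map_add.
Qed.

Lemma definable_nearc h f g : emap h -> emap f -> emap g ->
  dfn (fun p => nearc (h p) (f p) (g p)).
Proof.
by move=> mh mf mg; apply: definable_and; apply: definable_le => //;
  exact: env_map_add.
Qed.

Lemma definable_app2 E1 E2 {c1 : env R E1} {c2 : env R E2}
    (P : E1 -> E2 -> Prop) (h1 : E -> E1) (h2 : E -> E2) :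
  dfn (fun p : E1 * E2 => P p.1 p.2) ->
  emap h1 -> emap h2 -> dfn (fun p => P (h1 p) (h2 p)).
Proof.
move=> dP m1 m2; apply: (definable_comp (h := fun p => (h1 p, h2 p)) dP).
exact: env_map_pair.
Qed.

Lemma definable_app3 E1 E2 E3 {c1 : env R E1} {c2 : env R E2} {c3 : env R E3}
    (P : E1 -> E2 -> E3 -> Prop) (h1 : E -> E1) (h2 : E -> E2) (h3 : E -> E3) :
  dfn (fun p : E1 * E2 * E3 => P p.1.1 p.1.2 p.2) ->
  emap h1 -> emap h2 -> emap h3 ->
  dfn (fun p => P (h1 p) (h2 p) (h3 p)).
Proof.
move=> dP m1 m2 m3; apply: (definable_comp (h := fun p => (h1 p, h2 p,
  h3 p)) dP).
by do 2 apply: env_map_pair => //.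
Qed.

End Env.

Ltac env_ext := fail.

Ltac env_tac := repeat first
  [ apply: env_map_id | env_ext
  | apply: env_map_fst | apply: env_map_snd | apply: env_map_coord
  | apply: env_map_add | apply: env_map_pair | apply: env_map_cst
  | apply: env_map_cst_row ].

Ltac definability_hyp := match goal with
  | H : definable_on _ _ |- _ => first
    [ apply (definable_app3 H) | apply (definable_app2 H)
    | apply (definable_comp H) | exact H ]
  end.

Ltac definability_ext := fail.

Ltac definability_step := cbn beta; first
  [ apply (definable_cst _ zero)
  | definability_hyp
  | definability_ext
  | apply definable_lt | apply definable_le | apply definable_eq
  | apply definable_near | apply definable_nearc
  | apply definable_and | apply definable_and3 | apply definable_or
  | apply (definable_ex zero) | apply (definable_ex_row zero)
  | apply definable_not
  | apply definable_imply
  | apply (definable_all zero) | apply (definable_all_row zero)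
  | apply (definable_all_fin zero); intro ].

Ltac definability := repeat definability_step; env_tac.

Lemma nbhs_nearP (x : R) (A : set R) :
  nbhs x A <-> exists2 e, zero < e & forall y, near e x y -> A y.
Proof.
split=> [|[e e0 eA]].
  rewrite itv_nbhsE => -[[p q] [/= io xi] iA].
  (* Basic neighbourhoods may be unbounded; [l] and [u] replace the missing bounds. *)
  have [l [u /andP[lx xu]]] := R_noends x.
  suff [p' [q' [px xq pqA]]] : exists p' q', [/\ p' < x, x < q' &
      forall y, p' < y -> y < q' -> A y].
    by have [e e0 eP] := near_itv px xq; exists e => // y /eP[py yq];
      exact: pqA.
  case: p io xi iA => [[] p|[]]; case: q => [[] q|[]] //= _;
    rewrite in_itv /= ?andbT => xpq iA.
  - have /andP[px xq] := xpq; exists p, q; split=> // y py yq.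
    by apply: iA; rewrite /= in_itv /= py.
  - by exists p, u; split=> // y py _; apply: iA; rewrite /= in_itv /= py.
  - by exists l, q; split=> // y _ yq; apply: iA; rewrite /= in_itv /=.
  - by exists l, u; split=> // y _ _; apply: iA.
have [e' eE] := nearE e; apply: (@filterS _ _ _ [set y | near e x y]) => //.
suff -> : [set y | near e x y] = `]x [+] e', x [+] e[%classic.
  apply: open_nbhs_nbhs; split; first exact: itv_open.
  by rewrite /= in_itv /=; apply/andP/eE/near_refl.
apply/seteqP; split=> y /=; rewrite in_itv /=; last by move/andP/eE.
by move/eE/andP.
Qed.

Lemma closed_nearP (A : set R) :
  closed A <->
  forall x, (forall e, zero < e -> exists2 y, A y & near e x y) -> A x.
Proof.
split=> [cA x xA|cA x xA].
  apply: cA => B /nbhs_nearP[e /xA[y Ay xy] eB].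
  by exists y; split=> //; exact: eB.
apply: cA => e e0; have [|y [Ay xy]] := xA [set y | near e x y].
  by apply/nbhs_nearP; exists e.
by exists y.
Qed.

Hypothesis R_complete : definably_complete N.

Lemma definable1E (X : set R) : definable1 N X <-> dfn X.
Proof.
rewrite /definable1 (definable_onE _ zero); split=> dX.
  apply: (definable_ext _ (definable_comp (h := fun x : R =>
    \row_(i < 1) x)%R dX _)).
    by move=> x /=; rewrite mxE.
  by apply: env_map_row => _; env_tac.
by definability.
Qed.

(** * Definable completeness *)

(** Non-emptiness excludes the value [NInfty], and the bound [b] excludes [PInfty]. The third clause
    follows because a point slightly below [s] would otherwise be an upper bound. *)
Lemma sup_ex (Z : set R) b : dfn Z -> Z !=set0 -> (forall z, Z z -> z <= b) ->
  exists s, [/\ forall z, Z z -> z <= s,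
    forall u, (forall z, Z z -> z <= u) -> s <= u &
    forall e, zero < e -> exists z, [/\ Z z, z <= s & near e s z]].
Proof.
move=> /definable1E /R_complete[[s [sub slub]] _] [z0 Zz0] Zb.
case: s sub slub => [|s|] sub slub.
- by have /= := sub (Fin z0) (ex_intro2 _ _ _ Zz0 erefl).
- have {}sub z : Z z -> z <= s by move=> Zz; apply: (sub (Fin z)); exists z.
  have {}slub u : (forall z, Z z -> z <= u) -> s <= u.
    by move=> Zu; apply: (slub (Fin u)) => _ [z Zz <-]; exact: Zu.
  exists s; split=> // e e0; apply: contrapT => nZ.
  have [l [_ /andP[ls _]]] := R_noends s.
  have [u [_ us su]] := near_below ls e0.
  suff : s <= u by rewrite leNgt us.
  apply: slub => z Zz; have zs := sub z Zz.
  rewrite leNgt; apply/negP => uz; apply: nZ; exists z; split=> //.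
  by apply: (near_between (near_sym su)) => //; exact: ltW.
- suff : le_ext PInfty (Fin b) by [].
  by apply: (slub (Fin b)) => _ [z Zz <-]; exact: Zb.
Qed.

Lemma inf_ex (Z : set R) b : dfn Z -> Z !=set0 -> (forall z, Z z -> b <= z) ->
  exists s, [/\ forall z, Z z -> s <= z,
    forall u, (forall z, Z z -> u <= z) -> u <= s &
    forall e, zero < e -> exists z, [/\ Z z, s <= z & near e s z]].
Proof.
move=> /definable1E /R_complete[_ [s [sub slub]]] [z0 Zz0] Zb.
case: s sub slub => [|s|] sub slub.
- suff : le_ext (Fin b) NInfty by [].
  by apply: (slub (Fin b)) => _ [z Zz <-]; exact: Zb.
- have {}sub z : Z z -> s <= z by move=> Zz; apply: (sub (Fin z)); exists z.
  have {}slub u : (forall z, Z z -> u <= z) -> u <= s.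
    by move=> Zu; apply: (slub (Fin u)) => _ [z Zz <-]; exact: Zu.
  exists s; split=> // e e0; apply: contrapT => nZ.
  have [_ [l /andP[_ sl]]] := R_noends s.
  have [u [su _ nsu]] := near_above sl e0.
  suff : u <= s by rewrite leNgt su.
  apply: slub => z Zz; have zs := sub z Zz.
  rewrite leNgt; apply/negP => uz; apply: nZ; exists z; split=> //.
  by apply: (near_between nsu) => //; exact: ltW.
- by have /= := sub (Fin z0) (ex_intro2 _ _ _ Zz0 erefl).
Qed.

(** Definable completeness in place of compactness: let [s] be the supremum of the [z] such that one
    [h] works up to [z]. The neighbourhood given at [s] carries the property beyond [s], the smaller
    of the two values of [h] being valid on both parts. *)
Lemma interval_compact (W : R -> R -> Prop) p q :
  dfn (fun a : R * R => W a.1 a.2) ->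
  (forall e e' y, e' <= e -> W e y -> W e' y) ->
  (forall y, p <= y -> y <= q ->
     exists2 h, zero < h & forall y', near h y y' -> W h y') ->
  exists2 h, zero < h & forall y, p <= y -> y <= q -> W h y.
Proof.
move=> dW Wd Wl.
have [qp|pq] := ltP q p.
  by have [e e0] := pos_ex; exists e => // y py /(le_trans py);
    rewrite leNgt qp.
pose Z z := exists h, zero < h /\ forall y, p <= y -> y <= z -> y <= q -> W h y.
suff [h [h0 hP]] : Z q by exists h => // y py yq; exact: hP.
apply: contrapT => nZq.
have Zq z : Z z -> z <= q.
  move=> [h [h0 hP]]; rewrite leNgt; apply/negP => qz; apply: nZq.
  by exists h; split=> // y py yq _; apply: hP => //; exact: le_trans (ltW qz).
have Zp : Z p.
  have [h h0 hP] := Wl p (lexx _) pq; exists h; split=> // y py yp _.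
  by apply: hP; rewrite (le_anti (introT andP (conj yp py))); exact: near_refl.
have [|s [Zs slub sZ]] := sup_ex (Z := Z) _ (ex_intro _ p Zp) Zq;
  first by rewrite /Z; definability.
have sq : s <= q by exact: slub.
have [h h0 hP] := Wl s (Zs _ Zp) sq.
have [z [[hz [hz0 hzP]] zs sz]] := sZ h h0.
have [_ [u /andP[_ su]]] := R_noends s.
have [t [st _ nst]] := near_above su h0.
suff /Zs : Z t by rewrite leNgt st.
have [m0 mh mhz] := min_pos h0 hz0.
exists (Order.min h hz); split=> // y py yt yq.
have [yz|zy] := leP y z; first by apply: (Wd hz) => //; exact: hzP.
apply: (Wd h) => //; apply: hP; have [ys|sy] := leP y s.
  by apply: (near_between (near_sym sz)) => //; exact: ltW.
by apply: (near_between nst) => //; exact: ltW.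
Qed.


(** * Discrete subsets of the line *)

(* The point a need not belong to X: this says that X is closed and discrete. *)
Definition discrete1 (X : set R) : Prop :=
  forall a, exists2 h, zero < h & forall x, X x -> near h a x -> x = a.

Lemma discrete1S (X Y : set R) : X `<=` Y -> discrete1 Y -> discrete1 X.
Proof. by move=> XY dY a; have [h h0 hP] := dY a; exists h => // x /XY;
  exact: hP. Qed.

Lemma discrete1_min (X : set R) b : dfn X -> discrete1 X -> X !=set0 ->
  (forall x, X x -> b <= x) -> exists2 m, X m & forall x, X x -> m <= x.
Proof.
move=> dX X1 X0 Xb; have [m [Xm _ mX]] := inf_ex dX X0 Xb; exists m => //.
by have [h /mX[x [Xx _ mx]] hP] := X1 m; rewrite -(hP x).
Qed.

Section Tame.

(* Condition (1) of the theorem enters the development only through this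
   consequence: a definable subset of R which is dense in no interval has no
   accumulation point. *)
Hypothesis closed_tame : closed_discrete_or_interval N.

(** The closure [Y] of [X] contains no interval, so condition (1) makes it discrete; being closed as
    well, it has no accumulation point. *)
Lemma nowhere_dense1_discrete (X : set R) : dfn X ->
  (forall p q, p < q -> exists p' q', [/\ p <= p', p' < q', q' <= q &
     forall x, X x -> p' < x -> x < q' -> False]) ->
  discrete1 X.
Proof.
move=> dX Xnd.
pose Y : set R := [set x | forall e, zero < e -> exists y, X y /\ near e x y].
have dY : dfn Y by rewrite /Y /=; definability.
have cY : closed Y.
  apply/closed_nearP => x xY e e0; have [h h0 hh] := half_ex e0.
  have [y /(_ _ h0)[z [Xz yz]] xy] := xY h h0.
  by exists z; split=> //; apply: near_le hh _; exact: near_trans yz.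
have [dscY|[a [b [[m mab] abY]]]] :=
  closed_tame ((definable1E Y).2 dY) cY; last first.
  move: mab; rewrite /= in_itv /= => /andP[am mb].
  have [p [q [ap pq qb pqX]]] := Xnd _ _ (lt_trans am mb).
  have [c /andP[pc cq]] := R_dense pq.
  have [e e0 eP] := near_itv pc cq.
  have /(_ _ e0)[x [Xx /eP[px xq]]] : Y c.
    apply: abY => /=; rewrite in_itv /=.
    by rewrite (le_lt_trans ap pc) (lt_le_trans cq qb).
  by have := pqX x Xx px xq.
move=> a; have [Ya|/existsNP[e /not_implyP[e0 nX]]] := pselect (Y a);
  last first.
  by exists e => // x Xx ax; case: nX; exists x.
have [_ [V /nbhs_nearP[e e0 eV] VY]] := dscY _ Ya.
have /seteqP[VYa _] := VY.
exists e => // x Xx ax; apply: VYa; split; first exact: eV.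
by move=> e' e'0; exists x; split=> //; exact: near_refl.
Qed.

Lemma near_addl z h x y : near h (z [+] x) (z [+] y) <-> near h x y.
Proof. by rewrite /near -!addA !ltD2lE. Qed.

Lemma near_add_eq h x y w v : x [+] w = y [+] v -> near h w v -> near h x y.
Proof.
move=> xy [wv vw]; split.
  by rewrite -(ltD2rE w) xy -addA (addC h) ltD2lE.
by rewrite -(ltD2rE v) -xy -addA (addC h) ltD2lE.
Qed.

Definition chain (T U : Type) (X : T -> set U) : Prop :=
  forall t t', X t `<=` X t' \/ X t' `<=` X t.

(* If a were an accumulation point of the union, then the set of the distances
   from a to the nearest point of [X t] other than a, for varying t, would
   accumulate at 0; but above any of its elements this set lies in the set of
   distances from a to the points of a single [X t]. *)
Lemma discrete1_bigcup (X : R -> set R) :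
  dfn (fun p : R * R => X p.1 p.2) -> chain X -> (forall t, discrete1 (X t)) ->
  discrete1 (fun x => exists t, X t x).
Proof.
move=> dX Xc X1 a.
(* [Z t] collects the distances from [a] to the points of [X t] on its right ([a [+] w]) and on its
   left ([x [+] w = a]). *)
pose Z t w := zero < w /\ (X t (a [+] w) \/ exists x, X t x /\ x [+] w = a).
have dZ : dfn (fun p : R * R => Z p.1 p.2) by rewrite /Z; definability.
have Z1 t : discrete1 (Z t).
  move=> w0; have [h1 h10 h1P] := X1 t (a [+] w0).
  have [b bE] := sub_ex w0 a; have [h2 h20 h2P] := X1 t b.
  have [m0 mh1 mh2] := min_pos h10 h20; exists (Order.min h1 h2) => //.
  move=> w [_ [Xw|[x [Xx xw]]]] w0w.
    by apply/(@add_inj a)/h1P => //; apply/near_addl; exact: near_le w0w.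
  have bx : b [+] w0 = x [+] w by rewrite addC bE xw.
  have xb : x = b by apply: h2P => //; apply: near_add_eq bx (near_le mh2 w0w).
  by apply/(@add_inj b); rewrite bx xb.
have Zc t t' : X t `<=` X t' -> Z t `<=` Z t'.
  move=> tt' w [w0 H]; split=> //; case: H => [/tt'|[x [/tt' Xx xw]]];
    first by left.
  by right; exists x.
pose Y w := exists t, Z t w /\ forall w', Z t w' -> w <= w'.
have dY : dfn Y by rewrite /Y; definability.
have Y1 : discrete1 Y.
  apply: nowhere_dense1_discrete => // p q pq.
  (* The sign of [m] matters: below [zero] there is nothing in [Y], and above it any member [w0 < m]
     of [Y] confines the part of [Y] beyond [m] to a single [Z t0]. *)
  have [m [mz pm mq]] : exists m, [/\ m <> zero, p < m & m < q].
    have [m /andP[pm mq]] := R_dense pq.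
    have [mz|mz] := pselect (m = zero); last by exists m.
    have [m' /andP[mm' m'q]] := R_dense mq; exists m'.
    by split=> //; [move=> m'z; move: mm';
      rewrite m'z mz ltxx|exact: lt_trans mm'].
  have [m0|m0|//] := ltgtP m zero.
    exists p, m; split=> //; [exact: ltW|move=> x [t [[x0 _] _]] _ xm].
    by have := lt_trans (lt_trans x0 xm) m0; rewrite ltxx.
  have [[w0 [[t0 [Zw0 w0min]] w0m]]|nY] := pselect (exists w, Y w /\ w < m);
    last first.
    exists p, m; split=> //; [exact: ltW|move=> x Yx _ xm].
    by apply: nY; exists x.
  have [h h0 hP] := Z1 t0 m; have [q' [mq' q'q nq']] := near_above mq h0.
  exists m, q'; split=> //; [exact: ltW..|].
  move=> x [t [Zx xmin]] mx xq'.
  (* In the other case of the chain condition [X t0] is contained in [X t], so [w0] lies in [Z t]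
     below its minimum [x]. *)
  have Z0x : Z t0 x.
    have [/Zc|/Zc/(_ _ Zw0)/xmin] := Xc t t0; first exact.
    by rewrite leNgt (lt_trans w0m mx).
  suff xm : x = m by move: mx; rewrite xm ltxx.
  by apply: hP => //; apply: (near_between nq') => //; exact: ltW.
have [h h0 hP] := Y1 zero; exists h => // x [t Xx] ax; apply: contrapT => xa.
have [w [w0 wh Zw]] : exists w, [/\ zero < w, w < h & Z t w].
  have [ltax|ltxa|/esym//] := ltgtP a x.
    have [w wE] := sub_ex a x; have w0 : zero < w by rewrite -(lt_addr a) wE.
    exists w; split=> //; last by split=> //; left; rewrite wE.
    by rewrite -(ltD2lE a) wE; case: ax.
  have [w wE] := sub_ex x a; have w0 : zero < w by rewrite -(lt_addr x) wE.
  exists w; split=> //; last by split=> //; right; exists x.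
  by rewrite -(ltD2lE x) wE; case: ax.
have [||u Zu umin] := @discrete1_min (Z t) zero _ (Z1 t) (ex_intro _ w Zw).
- by definability.
- by move=> ? [/ltW].
have [u0 _] := Zu.
suff uz : u = zero by move: u0; rewrite uz ltxx.
apply: hP; first by exists t.
have uh := le_lt_trans (umin _ Zw) wh.
by split; [apply: lt_trans h0 _; rewrite addC lt_addr|rewrite add0].
Qed.


(** * Cubes and coordinates *)

Definition agree n (S : {set 'I_n}) (x y : 'rV[R]_n) : Prop :=
  forall i, i \in S -> x ord0 i = y ord0 i.

(** Subsets of R^S are represented by cylinders in R^n, so that inductions on the number of
    coordinates stay in one space. *)
Definition cylinder n (S : {set 'I_n}) (X : set 'rV[R]_n) : Prop :=
  forall x y : 'rV[R]_n, agree S x y -> X x -> X y.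

Definition upd n (x : 'rV[R]_n) (k : 'I_n) (a : R) : 'rV[R]_n :=
  (\row_i if i == k then a else x ord0 i)%R.

Definition merge n (S : {set 'I_n}) (x y : 'rV[R]_n) : 'rV[R]_n :=
  (\row_i if i \in S then x ord0 i else y ord0 i)%R.

Definition cube n (z : 'rV[R]_n) (e : R) : set 'rV[R]_n :=
  [set x | forall i, near e (z ord0 i) (x ord0 i)].

(** A first-order description of the closure, hence definable along with [X]; [open_clP] links it to
    the product topology. *)
Definition cl n (X : set 'rV[R]_n) : set 'rV[R]_n :=
  [set z | forall e, zero < e -> exists x, cube z e x /\ X x].

Section EnvRows.
Context {E : Type} {cE : env R E}.

Lemma env_map_upd n (h : E -> 'rV[R]_n) k (f : E -> R) :
  emap h -> emap f -> emap (fun p => upd (h p) k (f p)).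
Proof.
by move=> mh mf; apply: env_map_row => i; case: (i == k) => //; env_tac.
Qed.

Lemma definable_agree n S (h h' : E -> 'rV[R]_n) :
  emap h -> emap h' -> dfn (fun p => agree S (h p) (h' p)).
Proof. by move=> mh mh'; rewrite /agree; definability. Qed.

Lemma definable_cube n (h h' : E -> 'rV[R]_n) (f : E -> R) :
  emap h -> emap f -> emap h' -> dfn (fun p => cube (h p) (f p) (h' p)).
Proof. by move=> mh mf mh'; rewrite /cube /=; definability. Qed.

End EnvRows.

Ltac env_ext ::= apply: env_map_upd.

Ltac definability_ext ::= first
  [ apply definable_agree | apply definable_cube
  | progress unfold subset | progress unfold cl ].

Section Rows.
Context {n : nat}.
Implicit Types (x y z w : 'rV[R]_n) (S : {set 'I_n}) (k : 'I_n).
Implicit Types (X Y C : set 'rV[R]_n).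

Lemma agree_sym S x y : agree S x y -> agree S y x.
Proof. by move=> xy i /xy. Qed.

Lemma agree_trans S x y z : agree S x y -> agree S y z -> agree S x z.
Proof. by move=> xy yz i iS; rewrite xy ?yz. Qed.

Lemma agree_merge S x y : agree S (merge S x y) x.
Proof. by move=> i iS; rewrite mxE iS. Qed.

Lemma updE x k a : upd x k a ord0 k = a.
Proof. by rewrite mxE eqxx. Qed.

Lemma upd_id x k : upd x k (x ord0 k) = x.
Proof. by apply/rowP => i; rewrite mxE; case: eqP => [->|]. Qed.

Lemma upd_upd x k a b : upd (upd x k a) k b = upd x k b.
Proof. by apply/rowP => i; rewrite !mxE; case: eqP. Qed.

Lemma agree_upd S x y k a : agree S x y ->
  agree (k |: S) (upd x k a) (upd y k a).
Proof.
by move=> xy i; rewrite !inE !mxE; case: eqP => //= _ /xy.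
Qed.

Lemma cylinder_upd S k C a : cylinder (k |: S) C ->
  cylinder S (fun x => C (upd x k a)).
Proof. by move=> Cc x y xy; apply: (Cc (upd x k a) (upd y k a));
  exact: agree_upd. Qed.

Lemma cube_refl z e : zero < e -> cube z e z.
Proof. by move=> e0 i; exact: near_refl. Qed.

Lemma cube_sym z x e : cube z e x -> cube x e z.
Proof. by move=> zx i; exact/near_sym. Qed.

Lemma cube_le z e e' : e <= e' -> cube z e `<=` cube z e'.
Proof. by move=> ee' x zx i; exact: near_le (zx i). Qed.

Lemma cube_trans z y x e e' : cube z e y -> cube y e' x -> cube z (e [+] e') x.
Proof. by move=> zy yx i; exact: near_trans (zy i) (yx i). Qed.

Lemma cube_open z e x : cube z e x ->
  exists2 h, zero < h & cube x h `<=` cube z e.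
Proof.
move=> zx; have [||h h0 hP] := @fin_pos _ (fun i h => forall a,
    near h (x ord0 i) a -> near e (z ord0 i) a).
- by move=> i a b ba H c /(near_le ba) /H.
- by move=> i; exact: near_open (zx i).
- by exists h => // y xy i; exact: hP.
Qed.

Lemma cube_upd x y k a b h : cube x h y -> near h a b ->
  cube (upd x k a) h (upd y k b).
Proof. by move=> xy ab i; rewrite !mxE; case: eqP. Qed.

Lemma subset_cl X : X `<=` cl X.
Proof. by move=> x Xx e e0; exists x; split=> //; exact: cube_refl. Qed.

Lemma clS X Y : X `<=` Y -> cl X `<=` cl Y.
Proof. by move=> XY x xX e /xX[y [xy /XY Yy]]; exists y. Qed.

Lemma cl_cl X : cl (cl X) `<=` cl X.
Proof.
move=> z zX e /half_ex[h h0 hh]; have [y [zy /(_ _ h0)[x [yx Xx]]]] := zX h h0.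
by exists x; split=> //; apply: cube_le hh _ _; exact: cube_trans yx.
Qed.

Lemma cl_cylinder S X : cylinder S X -> cylinder S (cl X).
Proof.
move=> cX x y xy xX e e0; have [x' [xx' Xx']] := xX e e0.
exists (merge S x' y); split; last first.
  by apply: cX Xx'; apply/agree_sym/agree_merge.
move=> i; rewrite mxE; case: ifPn => [iS|_]; last exact: near_refl.
by rewrite -xy.
Qed.

Lemma cl_cube X z e x h : cube z e `<=` cl X -> cube z e x -> zero < h ->
  exists y, [/\ cube z e y, cube x h y & X y].
Proof.
move=> zX zx h0; have [h' h'0 h'P] := cube_open zx.
have [m0 mh mh'] := min_pos h0 h'0; have [y [xy Xy]] := zX x zx _ m0.
by exists y; split=> //; [apply: h'P|]; exact: cube_le xy.
Qed.

Lemma not_dense_cube X z e : zero < e -> ~ (cube z e `<=` cl X) ->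
  exists z' e', [/\ zero < e', cube z' e' `<=` cube z e &
    forall x, cube z' e' x -> ~ X x].
Proof.
move=> e0 /existsNP[x /not_implyP[zx /existsNP[h /not_implyP[h0 nX]]]].
have [h' h'0 h'P] := cube_open zx; have [m0 mh mh'] := min_pos h0 h'0.
exists x, (Order.min h h'); split=> // y xy; first by apply: h'P;
  exact: cube_le xy.
by move=> Xy; apply: nX; exists y; split=> //; exact: cube_le xy.
Qed.

End Rows.

(** A tube lemma: if [C] misses the segment over [x], then [interval_compact] gives one [h] for
    which [C] misses the segments over the whole [h]-cube at [x]. The abstract [f] covers both
    changing a coordinate ([upd]) and adding one ([cons_row]). *)
Lemma cl_proj n m (f : 'rV[R]_n -> R -> 'rV[R]_m) (C : set 'rV[R]_m) p q :
  emap (fun a : 'rV[R]_n * R => f a.1 a.2) ->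
  (forall x x' y y' h, cube x h x' -> near h y y' ->
    cube (f x y) h (f x' y')) ->
  dfn C -> cl C `<=` C ->
  let D := [set x | exists y, [/\ p <= y, y <= q & C (f x y)]] in cl D `<=` D.
Proof.
move=> mf fL dC cC D x xD; apply: contrapT => nDx.
have [|||h h0 hP] := @interval_compact
    (fun h y => forall x', cube x h x' -> ~ C (f x' y)) p q.
- apply: definable_all_row => //; apply: definable_imply; first by definability.
  apply/definable_not/(definable_comp (h := fun a => f a.2 a.1.2) dC).
  pose g (a : R * R * 'rV[R]_n) := (a.2, a.1.2).
  have mg : emap g by rewrite /g; env_tac.
  by move=> c cc; exact: (term_map_comp (mf _ cc) mg).
- by move=> e e' y ee' H x' /(cube_le ee') /H.
- move=> y py yq; apply: contrapT => nh; apply: nDx; exists y; split=> //.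
  apply: cC => h h0; apply: contrapT => nC; apply: nh;
    exists h => // y' yy' x' xx' Cx'.
  by apply: nC; exists (f x' y'); split=> //; exact: fL.
- by have [x' [xx' [y [py yq]]]] := xD h h0; exact: hP.
Qed.

(** * The Baire category theorem *)

Section Baire.
Context {n : nat}.
Implicit Types (x z w : 'rV[R]_n) (S : {set 'I_n}) (k : 'I_n).
Implicit Types (C : set 'rV[R]_n) (X : R -> set 'rV[R]_n).

(** Asking for a chain and not for an increasing family allows sets that shrink as [t] grows, such
    as the conditions holding at scale [t] below. *)
Definition baire S : Prop := forall X,
  dfn (fun p : R * 'rV[R]_n => X p.1 p.2) -> chain X ->
  (forall t, cylinder S (X t)) ->
  forall z e, zero < e -> cube z e `<=` cl [set x | exists t, X t x] ->
  exists t z' e',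
    [/\ zero < e', cube z' e' `<=` cube z e & cube z' e' `<=` cl (X t)].

(** Take for [c0] the infimum of the indices whose set is dense in some subcube, and for [c] such an
    index close to [c0]. The union of the sets of index below [c0] is dense in no subcube, as
    [baire] would give an index of that kind below [c0]; so it misses a smaller cube. *)
Lemma baire_localize S X u : baire S ->
  dfn (fun p : R * 'rV[R]_n => X p.1 p.2) ->
  (forall t t', t <= t' -> X t `<=` X t') ->
  (forall t, cylinder S (X t)) -> (forall t x, X t x -> u <= t) ->
  forall z e h, zero < e -> zero < h ->
  cube z e `<=` cl [set x | exists t, X t x] ->
  exists c0 c z' e', [/\ [/\ c0 <= c & near h c0 c],
    [/\ zero < e', cube z' e' `<=` cube z e & cube z' e' `<=` cl (X c)] &
    forall t x, t < c0 -> cube z' e' x -> ~ X t x].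
Proof.
move=> bS dX Xm Xc Xu z e h e0 h0 zX.
have Xch : chain X.
  by move=> t t'; have [/Xm|/ltW/Xm] := leP t t'; [left|right].
pose I c := exists z' e', [/\ zero < e', cube z' e' `<=` cube z e &
  cube z' e' `<=` cl (X c)].
have dI : dfn I by rewrite /I; definability.
have [c Ic] : exists c, I c by have [t H] := bS X dX Xch Xc z e e0 zX; exists t.
have [|c0 [c0I _ Ic0]] := @inf_ex I u dI (ex_intro _ c Ic).
  move=> c' [z' [e' [e'0 _ /(_ z' (cube_refl z' e'0))/(_ e' e'0)[x [_]]]]].
  exact: Xu.
have [c1 [[z1 [e1 [e10 z1z z1X]]] c0c1 nc01]] := Ic0 h h0.
pose Y t x := t < c0 /\ X t x.
have [|z' [e' [e'0 z'z1 z'Y]]] := @not_dense_cube _ [set x | exists t,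
  Y t x] z1 e1 e10.
  move=> z1Y; have [|||t [z2 [e2 [e20 z2z1 z2Y]]]] := bS Y _ _ _ z1 e1 e10 z1Y.
  - by rewrite /Y; definability.
  - move=> t t'; wlog tt' : t t' / t <= t' => [hw|].
      by have [/hw|/ltW/hw[]] := leP t t'; [|right|left].
    have [t'c|ct'] := ltP t' c0; first by left=> x [_ /(Xm _ _ tt')].
    by right=> x [t'c]; move: t'c; rewrite ltNge ct'.
  - by move=> t x y xy [tc0 /(Xc _ _ _ xy) Xy].
  - have [x [_ [tc0 _]]] := z2Y z2 (cube_refl z2 e20) e2 e20.
    suff : c0 <= t by rewrite leNgt tc0.
    apply: c0I; exists z2, e2; split=> //; first exact: subset_trans z1z.
    by apply: subset_trans z2Y _; apply: clS => y [].
exists c0, c1, z', e'; split=> //.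
- by split=> //; [exact: subset_trans z1z|exact: subset_trans z1X].
- by move=> t x tc0 /z'Y nY Xtx; apply: nY; exists t.
Qed.


Definition has_interval (X : set R) : Prop :=
  exists p q, p < q /\ forall y, p <= y -> y <= q -> X y.

Definition cubeless C : Prop := forall z e, zero < e -> ~ (cube z e `<=` C).

(* A Kuratowski-Ulam theorem. By [baire] the fibres may be assumed to contain
   an interval of a fixed length, and by [baire_localize] the left endpoints of
   these intervals may be assumed to be close to each other, so that the
   intervals overlap. *)
Lemma fibre_has_interval S k C u : baire S -> dfn C -> cl C `<=` C ->
  cylinder (k |: S) C -> (forall x, C x -> u <= x ord0 k) -> cubeless C ->
  cubeless (cl [set x | has_interval [set a | C (upd x k a)]]).
Proof.
move=> bS dC clC cC Cu C0 z e e0 zB.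
pose B t x := zero < t /\ exists p, forall y, p <= y -> y <= p [+] t ->
  C (upd x k y).
have [||||t [z1 [e1 [e10 z1z z1B]]]] := bS B _ _ _ z e e0.
- by rewrite /B; definability.
- move=> t t'; wlog tt' : t t' / t <= t' => [hw|].
    by have [/hw|/ltW/hw[]] := leP t t'; [|right|left].
  have [t0|nt0] := pselect (zero < t); last by left=> x [].
  right=> x [_ [p pP]]; split=> //; exists p => y py yp; apply: pP => //.
  by apply: le_trans yp _; rewrite leD2lE.
- by move=> t x y xy [t0 [p pP]]; split=> //; exists p => a pa ap;
    apply: (cylinder_upd cC xy); exact: pP.
- apply: subset_trans zB _; apply: clS => x [p [q [pq pqC]]].
  have [t tE] := sub_ex p q; exists t; split; first by rewrite -(lt_addr p) tE.
  by exists p; rewrite tE.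
have t0 : zero < t by have [x [_ []]] := z1B z1 (cube_refl z1 e10) e1 e10.
have [h h0 hht] := half_ex t0.
(* [D p] says that some segment of length [t] in the fibre starts at or below [p], which is
   increasing in [p] as [baire_localize] requires. *)
pose D p x := exists p', p' <= p /\
  forall y, p' <= y -> y <= p' [+] t -> C (upd x k y).
have Dge p' x : (forall y, p' <= y -> y <= p' [+] t -> C (upd x k y)) ->
  u <= p'.
  move=> H; rewrite -(updE x k p'); apply/Cu/H => //.
  by rewrite ltW // lt_addr.
have [||||| c0 [c [z2 [e2 [[c0c nc0c] [e20 z2z1 z2D] Dc0]]]]] :=
  @baire_localize S D u bS _ _ _ _ z1 e1 h e10 h0.
- by rewrite /D; definability.
- by move=> p q pq x [p' [p'p H]]; exists p'; split=> //; exact: le_trans pq.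
- move=> p x y xy [p' [p'p H]]; exists p'; split=> // a pa ap.
  by apply: (cylinder_upd cC xy); exact: H.
- by move=> p x [p' [p'p /Dge up']]; exact: le_trans up' p'p.
- by apply: subset_trans z1B _; apply: clS => x [_ [p pP]]; exists p, p.
have ch : c < c0 [+] t.
  have [_ ch] := nc0c; apply: lt_le_trans ch _; rewrite leD2lE.
  by apply: le_trans hht; rewrite ltW // lt_addr.
(* A segment of length [t] starting between [c0] and [c] contains everything from [c] to [c0 [+] t].
   So [m] is interior to all of them, and a cube around height [m] lies in the closed set [C]. *)
have [m /andP[cm mt]] := R_dense ch.
have [h1 h10 h1P] := near_itv cm mt; have [m0 me2 mh1] := min_pos e20 h10.
apply: (C0 (upd z2 k m) (Order.min e2 h1) m0) => x xw.
have := xw k; rewrite updE => /(near_le mh1)/h1P[cx xt].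
have zx : cube z2 e2 (upd x k (z2 ord0 k)).
  move=> i; have := xw i; rewrite !mxE; case: eqP => [->|_]; first by move=> _;
    exact: near_refl.
  exact: near_le.
apply: clC => a a0; have [y [z2y xy [p' [p'c pP]]]] := cl_cube z2D zx a0.
exists (upd y k (x ord0 k)); split.
  rewrite -{1}(upd_id x k) -(upd_upd x k (z2 ord0 k)).
  by apply: cube_upd xy _; exact: near_refl.
apply: (pP); first exact: le_trans (ltW cx).
apply: le_trans (ltW xt) _; rewrite leD2rE leNgt; apply/negP => p'c0.
apply: (Dc0 p' y p'c0 z2y); exists p'; split; [exact: lexx|exact: pP].
Qed.

(** A closed fibre that is dense in an interval contains a smaller one, so a fibre without interval
    is nowhere dense. *)
Lemma fibre_discrete k C x : dfn C -> cl C `<=` C ->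
  ~ has_interval [set a | C (upd x k a)] -> discrete1 [set a | C (upd x k a)].
Proof.
move=> dC cC nI; apply: nowhere_dense1_discrete => [|p q pq].
  by apply: (definable_comp (h := fun a => upd x k a) dC); env_tac.
apply: contrapT => nE; apply: nI.
have [p1 /andP[pp1 p1q]] := R_dense pq;
  have [q1 /andP[p1q1 q1q]] := R_dense p1q.
exists p1, q1; split=> // y p1y yq1; apply: cC => h h0.
have [y' [yy' y'q nyy']] := near_above (le_lt_trans yq1 q1q) h0.
apply: contrapT => nC; apply: nE; exists y, y'; split=> //.
- exact: le_trans (ltW pp1) p1y.
- exact: ltW.
- move=> a Ca ya ay'; apply: nC; exists (upd x k a); split=> //.
  apply: cube_upd; first exact: cube_refl.
  by apply: (near_between nyy') => //; exact: ltW.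
Qed.

Lemma baire_step S k : k \notin S -> baire S -> baire (k |: S).
Proof.
move=> kS bS X dX Xc cX z e e0 zX; apply: contrapT => nE.
have [h h0 hhe] := half_ex e0.
have he : h < e by apply: lt_le_trans hhe; rewrite lt_addr.
(* Cutting the closure down to a closed cube of radius [h < e] bounds the coordinate [k] and keeps
   the set closed. By [nE] it contains no cube, which is [C0] below. *)
pose C t x := cl (X t) x /\ forall i, i \in k |: S ->
  nearc h (z ord0 i) (x ord0 i).
have dC : dfn (fun p : R * 'rV[R]_n => C p.1 p.2).
  by rewrite /C; definability.
have dCt t : dfn (C t) by apply: (definable_comp (h := fun x => (t, x)) dC);
  env_tac.
have Cch : chain C.
  by move=> t t'; have [/clS tt'|/clS tt'] := Xc t t'; [left|right] => x [/tt'].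
have clC t : cl (C t) `<=` C t.
  move=> x xC; split; first by apply/cl_cl/(clS _ xC) => y [].
  move=> i iS; apply: contrapT => /nearc_closed[a a0 aP].
  have [y [xy [_ /(_ i iS)]]] := xC a a0.
  by apply: aP => //; exact: near_refl.
have cC t : cylinder (k |: S) (C t).
  move=> x y xy [Xx Cx]; split; first exact: (cl_cylinder (cX t) xy).
  by move=> i iS; rewrite -xy //; exact: Cx.
have C0 t : cubeless (C t).
  move=> w a a0 waC; apply: nE.
  have [m0 ma mh] := min_pos a0 h0.
  exists t, (merge (k |: S) w z), (Order.min a h).
  have H x : cube (merge (k |: S) w z) (Order.min a h) x ->
      C t (merge (k |: S) x w).
    move=> wx; apply: waC => i; have := wx i; rewrite !mxE.
    by case: ifP => _; [exact: near_le|move=> _; exact: near_refl].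
  split=> // x wx.
    have [_ Cx] := H x wx; move=> i.
    have [iS|iS] := boolP (i \in k |: S).
      by have := Cx i iS; rewrite mxE iS; exact: nearc_near.
    have := wx i; rewrite mxE (negbTE iS) => /(near_le mh).
    exact/near_le/ltW.
  have [Xx _] := H x wx; apply: (cl_cylinder (cX t)) Xx; exact: agree_merge.
have [u uE] := sub_ex h (z ord0 k).
have Cu t x : C t x -> u <= x ord0 k.
  move=> [_ /(_ k)]; rewrite setU11 => /(_ isT)[+ _].
  by rewrite -uE addC leD2rE.
pose B t x := has_interval [set a | C t (upd x k a)].
(* If the fibres in direction [k] had intervals over a dense set, then by [bS] this would happen
   densely for a single [t], against [fibre_has_interval]. Otherwise all fibres over a subcube are
   discrete, and so are their unions [F x]. *)
have [W0X|/not_dense_cube] := pselect (cube z h `<=` cl [set x | exists t,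
  B t x]).
  have [|||t [z1 [e1 [e10 _ z1B]]]] := bS B _ _ _ z h h0 W0X.
  - by rewrite /B /has_interval /=; definability.
  - move=> t t'; have [tt'|tt'] := Cch t t'; [left|right];
    by move=> x [p [q [pq H]]]; exists p, q; split=> // y py yq; apply/tt'/H.
  - move=> t x y xy [p [q [pq H]]]; exists p, q; split=> // a pa aq.
    by apply: (cylinder_upd (cC t) xy); exact: H.
  exact: (fibre_has_interval bS (dCt t) (clC t) (cC t) (Cu t) (C0 t) e10 z1B).
move=> /(_ h0)[z1 [e1 [e10 z1z z1B]]].
pose a := z ord0 k.
pose F x y := exists t, C t (upd x k y).
have F1 x : cube z1 e1 x -> discrete1 (F x).
  move=> /z1B nB; apply: (@discrete1_bigcup (fun t y => C t (upd x k y))).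
  - by definability.
  - by move=> t t'; have [tt'|tt'] := Cch t t'; [left|right] => y; exact: tt'.
  - move=> t; apply: fibre_discrete => // Bt; apply: nB; by exists t.
(* An isolation radius [s] of [a] in [F x] depends on [x]; [bS] makes one [s] valid on a dense
   subset of a cube. *)
pose G s x := zero < s /\ forall y, F x y -> near s a y -> y = a.
have [||||s [z2 [e2 [e20 z2z1 z2G]]]] := bS G _ _ _ z1 e1 e10.
- by rewrite /G /F; definability.
- move=> t t'; wlog tt' : t t' / t <= t' => [hw|].
    by have [/hw|/ltW/hw[]] := leP t t'; [|right|left].
  have [t0|nt0] := pselect (zero < t); last by left=> x [].
  by right=> x [_ H]; split=> // y Fy /(near_le tt'); exact: H.
- move=> t x y xy [t0 H]; split=> // b [t' Cb]; apply: H; exists t'.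
  exact: (cylinder_upd (cC t') (agree_sym xy)).
- move=> x /F1 /(_ a)[s s0 sP]; apply: subset_cl; exists s; split=> //.
have s0 : zero < s by have [x [_ []]] := z2G z2 (cube_refl z2 e20) e2 e20.
have [m0 ms mh] := min_pos s0 h0.
have [_ [v /andP[_ av]]] := R_noends a.
have [q [aq _ naq]] := near_above av m0.
have [p /andP[ap pq]] := R_dense aq.
(* The segment from [p] to [q] avoids [a] but lies within [s] of it. Density of the union of the
   [X t] puts points of some [C t] there over a dense set of [x], hence, [H t] being closed, for one
   [t] over a whole cube; this contradicts [G s]. *)
pose H t x := exists y, [/\ p <= y, y <= q & C t (upd x k y)].
have clH t : cl (H t) `<=` H t.
  apply: (cl_proj (f := fun x y => upd x k y)) => //; first by env_tac.
  by move=> x x' y y' b; exact: cube_upd.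
have [||||t [z3 [e3 [e30 z3z2 z3H]]]] := bS H _ _ _ z2 e2 e20.
- by rewrite /H; definability.
- by move=> t t'; have [tt'|tt'] := Cch t t'; [left|right];
    move=> x [y [py yq Cy]]; exists y; split=> //; exact: tt'.
- move=> t x y xy [b [pb bq Cb]]; exists b; split=> //.
  exact: (cylinder_upd (cC t) xy).
- move=> x z2x b b0; have [m /andP[pm mq]] := R_dense pq.
  have zw : cube z h (upd x k m).
    move=> i; rewrite mxE; case: eqP => [->|_]; last exact/z1z/z2z1.
    apply: near_le mh _; apply: (near_between naq) => //; apply: ltW => //.
      exact: lt_trans ap pm.
  have [r r0 rP] := cube_open zw; have [r' r'0 r'P] := near_itv pm mq.
  have [n0 nb nr] := min_pos b0 r0; have [l0 ln lr'] := min_pos n0 r'0.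
  have [y [wy [t Xy]]] := zX _ (cube_le (ltW he) zw) _ l0.
  exists (upd y k (x ord0 k)); split.
    rewrite -{1}(upd_id x k) -(upd_upd x k m).
    apply: cube_upd; last exact: near_refl.
    exact: cube_le (le_trans ln nb) _ wy.
  exists t, (y ord0 k).
  have := wy k; rewrite updE => /(near_le lr')/r'P[py yq].
  split; [exact: ltW|exact: ltW|].
  rewrite upd_upd upd_id; split; first exact: subset_cl.
  by move=> i _; apply/near_nearc/(rP y)/(cube_le (le_trans ln nr)).
have [x [z3x _ [_ Gx]]] :=
  cl_cube (subset_trans z3z2 z2G) (cube_refl z3 e30) e30.
have [y [py yq Cy]] := clH _ _ (z3H x z3x).
have ay : a < y by exact: lt_le_trans py.
suff ya : y = a by move: ay; rewrite ya ltxx.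
apply: Gx; first by exists t.
by apply: (near_between (near_le ms naq)) => //; exact: ltW.
Qed.

Lemma baireT S : baire S.
Proof.
elim: {S}#|S| {-2}S (erefl #|S|) => [|m IH] S Sm.
  (* A cylinder over the empty set of coordinates is empty or the whole space. *)
  move=> X dX Xc cX z e e0 zX;
    have [x [zx [t Xx]]] := zX z (cube_refl z e0) e e0.
  exists t, z, e; split=> // y _; apply/subset_cl/(cX t x y) => // i.
  by rewrite (cards0_eq Sm) inE.
have [k kS] : exists k, k \in S by apply/card_gt0P; rewrite Sm.
rewrite -(finset.setD1K kS); apply: baire_step; first by rewrite !inE eqxx.
by apply: IH; move: Sm; rewrite (cardsD1 k) kS => -[].
Qed.

End Baire.

(** * D_Sigma sets *)

Definition box n (r : R) : set 'rV[R]_n :=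
  [set x | forall i, nearc r zero (x ord0 i)].
Arguments box {n} r.

Definition proj n (S : {set 'I_n}) (A : set 'rV[R]_n) : set 'rV[R]_n :=
  [set x | exists a, A a /\ agree S a x].

Definition cons_row n (a : R) (x : 'rV[R]_n) : 'rV[R]_n.+1 :=
  (\row_i if unlift ord0 i is Some j then x ord0 j else a)%R.

(* The D_Sigma sets of Miller and Speissegger. *)
Definition sigma_family n (F : R -> R -> set 'rV[R]_n) : Prop :=
  [/\ dfn (fun p : R * R * 'rV[R]_n => F p.1.1 p.1.2 p.2),
      forall r r' s s', r <= r' -> s' <= s -> F r s `<=` F r' s',
      forall r s, cl (F r s) `<=` F r s &
      forall r s, F r s `<=` box r].

Definition family_union n (F : R -> R -> set 'rV[R]_n) : set 'rV[R]_n :=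
  [set x | exists r s, zero < s /\ F r s x].

Definition sigma n (A : set 'rV[R]_n) : Prop :=
  exists2 F, sigma_family F & A = family_union F.

Section Box.
Context {n : nat}.
Implicit Types (x z : 'rV[R]_n) (S : {set 'I_n}).

Lemma fin_large (I : finType) (P : I -> R -> Prop) :
  (forall i e e', e <= e' -> P i e -> P i e') ->
  (forall i, exists e, P i e) -> exists e, forall i, P i e.
Proof.
move=> Pu Pe.
suff [e eP] : exists e, forall i, i \in enum I -> P i e.
  by exists e => i; apply: eP; rewrite mem_enum.
elim: (enum I) => [|i s [e IH]]; first by exists zero.
have [e' ie'] := Pe i.
exists (Order.max e e') => j; rewrite inE => /orP[/eqP ->|/IH].
  by apply: Pu ie'; rewrite le_max lexx orbT.
by apply: Pu; rewrite le_max lexx.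
Qed.

Lemma box_le r r' : r <= r' -> box r `<=` @box n r'.
Proof.
move=> rr' x xr i; have [h k] := xr i.
by split; [apply: le_trans h _|apply: le_trans k _]; rewrite leD2lE.
Qed.

Lemma box_ex x : exists r, box r x.
Proof.
apply: (@fin_large _ (fun i r => nearc r zero (x ord0 i))) =>
  [i e e' ee' [h k]|i].
  by split; [apply: le_trans h _|apply: le_trans k _]; rewrite leD2lE.
have [a0|/ltW a0] := leP zero (x ord0 i).
  by exists (x ord0 i); rewrite /nearc add0 lexx; split=> //;
    apply: le_trans (a0) _; rewrite -{1}(addr0 (x ord0 i)) leD2lE.
have [r rE] := sub_ex (x ord0 i) zero; exists r; rewrite /nearc rE add0 lexx.
by split=> //; apply: le_trans (a0) _; rewrite -rE -{2}(add0 r) leD2rE.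
Qed.

Lemma cl_box r : cl (box r) `<=` @box n r.
Proof.
move=> x xr i; apply: contrapT => /nearc_closed[h h0 hP].
have [y [xy /(_ i) yr]] := xr h h0; apply: hP yr => //; exact: near_refl.
Qed.

Lemma clI (A B : set 'rV[R]_n) : cl A `<=` A -> cl B `<=` B ->
  cl (A `&` B) `<=` A `&` B.
Proof.
by move=> clA clB x xAB; split;
  [apply/clA/(clS _ xAB) => y []|apply/clB/(clS _ xAB) => y []].
Qed.

Lemma clU (A B : set 'rV[R]_n) : cl A `<=` A -> cl B `<=` B ->
  cl (A `|` B) `<=` A `|` B.
Proof.
move=> clA clB x xAB; apply: contrapT => /not_orP[nA nB].
have /existsNP[a /not_implyP[a0 aA]] : ~ cl A x by move/clA.
have /existsNP[b /not_implyP[b0 bB]] : ~ cl B x by move/clB.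
have [m0 ma mb] := min_pos a0 b0; have [y [xy [Ay|By]]] := xAB _ m0.
  by apply: aA; exists y; split=> //; exact: cube_le xy.
by apply: bB; exists y; split=> //; exact: cube_le xy.
Qed.

Lemma agreeT x z : agree [set: 'I_n]%SET x z -> x = z.
Proof. by move=> xz; apply/rowP => i; apply: xz; rewrite inE. Qed.

Lemma proj_cylinder S (A : set 'rV[R]_n) : cylinder S (proj S A).
Proof.
by move=> x z xz [a [Aa ax]]; exists a; split=> //; exact: agree_trans xz.
Qed.

Lemma projS S (A B : set 'rV[R]_n) : A `<=` B -> proj S A `<=` proj S B.
Proof. by move=> AB x [a [/AB Ba ax]]; exists a. Qed.

Lemma subset_proj S (A : set 'rV[R]_n) : A `<=` proj S A.
Proof. by move=> x Ax; exists x. Qed.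

Lemma proj_setU1 k S (A : set 'rV[R]_n) x : k \notin S ->
  proj S A x <-> exists y, proj (k |: S) A (upd x k y).
Proof.
move=> kS; split=> [[a [Aa ax]]|[y [a [Aa ax]]]].
  exists (a ord0 k), a; split=> // i; rewrite !inE mxE.
  by case: eqP => [->//|_] /= /ax.
exists a; split=> // i iS; rewrite (ax i) ?inE ?iS ?orbT // mxE.
by case: eqP => // ik; rewrite ik (negbTE kS) in iS.
Qed.

Lemma definable_proj S (A : set 'rV[R]_n) : dfn A -> dfn (proj S A).
Proof. by move=> dA; rewrite /proj /=; definability. Qed.

(** The coordinates outside [S] are projected away one at a time. Each stays between [p], the
    opposite of [r], and [r], so [cl_proj] applies. *)
Lemma cl_proj_box S (C : set 'rV[R]_n) r : dfn C -> cl C `<=` C ->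
  C `<=` box r ->
  cl (proj S C) `<=` proj S C.
Proof.
move=> dC clC Cr; elim: {S}#|~: S|%SET {-2}S (erefl #|~: S|%SET) =>
  [|m IH] S Sm.
  have -> : S = [set: 'I_n]%SET by rewrite -(finset.setCK S) (cards0_eq Sm) finset.setC0.
  have -> : proj [set: 'I_n]%SET C = C; last by [].
  apply/seteqP; split; last exact: subset_proj.
  by move=> x [a [Ca /agreeT <-]].
have [k] : exists k, k \in (~: S)%SET by apply/card_gt0P; rewrite Sm.
rewrite inE => kS; have [p pE] := sub_ex r zero.
have clk : cl (proj (k |: S) C) `<=` proj (k |: S) C.
  apply: IH; apply/eqP; rewrite -eqSS -Sm (cardsD1 k (~: S)%SET) inE kS.
  by rewrite finset.setCU finset.setDE finset.setIC.
have -> : proj S C = [set x | exists y, [/\ p <= y, y <= r &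
  proj (k |: S) C (upd x k y)]].
  apply/seteqP; split=> x; rewrite /= (proj_setU1 C x kS) => -[y];
    last by case; exists y.
  move=> [a [Ca ax]]; exists y; have := Cr a Ca k.
  rewrite ax ?setU11 // updE => -[yr yl]; split.
  - by rewrite -(leD2rE r) addC pE.
  - by move: yl; rewrite add0.
  - by exists a.
apply: (cl_proj (f := fun x y => upd x k y)) => //.
- by env_tac.
- by move=> x x' y y' h; exact: cube_upd.
- exact: definable_proj.
Qed.

End Box.

(** * Closure properties and Baire category for D_Sigma sets *)

Section Sigma.
Context {n : nat}.
Implicit Types (S : {set 'I_n}) (A B U C : set 'rV[R]_n) (F G : R -> R ->
  set 'rV[R]_n).

Lemma definable_sigma A : sigma A -> dfn A.
Proof. by move=> [F [dF _ _ _] ->]; rewrite /family_union /=; definability. Qed.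

Lemma definable_box {E} {cE : env R E} (f : E -> R) (h : E -> 'rV[R]_n) :
  emap f -> emap h -> dfn (fun p => box (f p) (h p)).
Proof. by move=> mf mh; rewrite /box /=; definability. Qed.

Lemma sigma_closed C : dfn C -> cl C `<=` C -> sigma C.
Proof.
move=> dC clC; exists (fun r _ => C `&` box r).
  split.
  - by apply: definable_and; [definability|apply: definable_box; env_tac].
  - by move=> r r' _ _ rr' _ x [Cx /(box_le rr')].
  - by move=> r _; apply: clI => //; exact: cl_box.
  - by move=> r _ x [].
apply/seteqP; split=> [x Cx|x [r [_ [_ []]]] //].
have [r xr] := box_ex x; have [s s0] := pos_ex.
by exists r, s.
Qed.

Lemma sigma_open U : dfn U -> cl (~` U) `<=` ~` U -> sigma U.
Proof.
move=> dU clU; exists (fun r s => [set x | box r x /\ forall y, cube x s y ->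
  U y]).
  split.
  - by apply: definable_and; [apply: definable_box; env_tac|definability].
  - move=> r r' s s' rr' ss' x [/(box_le rr') xr H]; split=> // y xy.
    by apply: H; exact: cube_le xy.
  - move=> r s x xF; split.
      by apply: cl_box; apply: clS xF => y [].
    move=> y /cube_sym /cube_open[h h0 hP].
    have [x' [xx' [_ H]]] := xF h h0.
    by apply/H/cube_sym/hP.
  - by move=> r s x [].
apply/seteqP; split=> [x Ux|x [r [s [s0 [_ H]]]]]; last exact/H/cube_refl.
have [r xr] := box_ex x.
have /existsNP[s /not_implyP[s0 sU]] : ~ cl (~` U) x by move/clU.
exists r, s; split=> //; split=> // y xy; apply: contrapT => nU.
by apply: sU; exists y.
Qed.

Lemma sigmaU A B : sigma A -> sigma B -> sigma (A `|` B).
Proof.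
move=> [F [dF mF clF bF] ->] [G [dG mG clG bG] ->].
exists (fun r s => F r s `|` G r s).
  split.
  - by rewrite /setU /=; definability.
  - by move=> r r' s s' rr' ss' x [/(mF _ _ _ _ rr' ss')|/(mG _ _ _ _ rr' ss')]; [left|right].
  - by move=> r s; exact: clU.
  - by move=> r s x [/bF|/bG].
apply/seteqP; split=> [x [[r [s [s0 H]]]|[r [s [s0 H]]]]|x [r [s [s0 [H|H]]]]].
- by exists r, s; split=> //; left.
- by exists r, s; split=> //; right.
- by left; exists r, s.
- by right; exists r, s.
Qed.

Lemma sigmaI A B : sigma A -> sigma B -> sigma (A `&` B).
Proof.
move=> [F [dF mF clF bF] ->] [G [dG mG clG bG] ->].
exists (fun r s => F r s `&` G r s).
  split.
  - by rewrite /setI /=; definability.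
  - by move=> r r' s s' rr' ss' x [/(mF _ _ _ _ rr' ss') ? /(mG _ _ _ _ rr' ss')].
  - by move=> r s; exact: clI.
  - by move=> r s x [/bF].
apply/seteqP; split=> [x [[r [s [s0 H]]] [r' [s' [s'0 H']]]]|x [r [s [s0 [H H']]]]].
  have [m0 ms ms'] := min_pos s0 s'0.
  exists (Order.max r r'), (Order.min s s'); split=> //; split.
    by apply: mF H => //; rewrite le_max lexx.
  by apply: mG H' => //; rewrite le_max lexx orbT.
by split; exists r, s.
Qed.

(** The projection is kept as a cylinder, in general unbounded; intersecting with [box r] restores
    the bound that a [sigma_family] must have. *)
Lemma sigma_family_proj S F : sigma_family F ->
  sigma_family (fun r s => box r `&` proj S (F r s)).
Proof.
move=> [dF mF clF bF]; split.
- apply: definable_and; first by apply: definable_box; env_tac.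
  by rewrite /proj /=; definability.
- move=> r r' s s' rr' ss' x [/(box_le rr') xr /(projS (mF _ _ _ _ rr' ss'))].
  by [].
- move=> r s; apply: clI; first exact: cl_box.
  apply: (@cl_proj_box _ _ _ r) => //.
  by apply: (definable_comp (h := fun x => (r, s, x)) dF); env_tac.
- by move=> r s x [].
Qed.

Lemma family_union_proj S F : sigma_family F ->
  proj S (family_union F) = family_union (fun r s => box r `&` proj S (F r s)).
Proof.
move=> [dF mF clF bF]; apply/seteqP; split=> x.
  move=> [a [[r [s [s0 Fa]]] ax]]; have [r' xr'] := box_ex x.
  exists (Order.max r r'), s; split=> //; split.
    by apply: box_le xr'; rewrite le_max lexx orbT.
  by exists a; split=> //; apply: mF Fa => //; rewrite le_max lexx.
by move=> [r [s [s0 [_ [a [Fa ax]]]]]]; exists a; split=> //; exists r, s.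
Qed.

Lemma sigma_proj S A : sigma A -> sigma (proj S A).
Proof.
move=> [F sF ->]; rewrite family_union_proj //; eexists; last by [].
exact: sigma_family_proj.
Qed.

(** Baire category is applied in [r] to the unions over [s], then in [s] with [r] fixed. Putting
    [zero < s] inside the sets makes them empty for the other [s], so that they still form a
    chain. *)
Lemma baire2 G : dfn (fun p : R * R * 'rV[R]_n => G p.1.1 p.1.2 p.2) ->
  (forall r r' s s', r <= r' -> s' <= s -> G r s `<=` G r' s') ->
  forall z e, zero < e -> cube z e `<=` cl (family_union G) ->
  exists r s z' e', [/\ zero < s, zero < e', cube z' e' `<=` cube z e &
    cube z' e' `<=` cl (G r s)].
Proof.
move=> dG mG z e e0 zG.
have [||||r [z1 [e1 [e10 z1z z1G]]]] :=
    @baireT n [set: 'I_n]%SET (fun r => [set x | exists s,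
      zero < s /\ G r s x]) _ _ _ z e e0.
- by definability.
- move=> r r'; wlog rr' : r r' / r <= r' => [hw|].
    by have [/hw|/ltW/hw[]] := leP r r'; [|right|left].
  by left=> x [s [s0 H]]; exists s; split=> //; apply: mG H.
- by move=> r x y /agreeT ->.
- by apply: subset_trans zG _; apply: clS => x [r [s H]]; exists r, s.
have [||||s [z2 [e2 [e20 z2z1 z2G]]]] :=
    @baireT n [set: 'I_n]%SET (fun s => [set x |
      zero < s /\ G r s x]) _ _ _ z1 e1 e10.
- by definability.
- move=> s s'; wlog ss' : s s' / s <= s' => [hw|].
    by have [/hw|/ltW/hw[]] := leP s s'; [|right|left].
  have [s0|s0] := pselect (zero < s); last by left=> x [].
  by right=> x [_ H]; split=> //; apply: mG H.
- by move=> s x y /agreeT ->.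
- exact: subset_trans z1G _.
have [x [_ [s0 _]]] := z2G z2 (cube_refl z2 e20) e2 e20.
exists r, s, z2, e2; split=> //; first exact: subset_trans z1z.
by apply: subset_trans z2G _; apply: clS => y [].
Qed.

Lemma sigma_family_baire F z e : sigma_family F -> zero < e ->
  cube z e `<=` cl (family_union F) ->
  exists r s z' e', [/\ zero < s, zero < e', cube z' e' `<=` cube z e &
    cube z' e' `<=` F r s].
Proof.
move=> [dF mF clF bF] e0 zF.
have [r [s [z' [e' [s0 e'0 z'z z'F]]]]] := baire2 dF mF e0 zF.
by exists r, s, z', e'; split=> //; apply: subset_trans z'F _.
Qed.

Lemma sigma_dichotomy A z e : sigma A -> zero < e ->
  exists z' e', [/\ zero < e', cube z' e' `<=` cube z e &
    cube z' e' `<=` A \/ forall x, cube z' e' x -> ~ A x].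
Proof.
move=> [F sF ->] e0.
have [zF|nz] := pselect (cube z e `<=` cl (family_union F)).
  have [r [s [z' [e' [s0 e'0 z'z z'F]]]]] := sigma_family_baire sF e0 zF.
  by exists z', e'; split=> //; left=> x /z'F Fx; exists r, s.
have [z' [e' [e'0 z'z z'F]]] := not_dense_cube e0 nz.
by exists z', e'; split=> //; right.
Qed.

(** If fibres of the [F r s] with an interval were dense, a single closed [F r s] would contradict
    [fibre_has_interval]. Over a cube free of them, [discrete1_bigcup] is used twice, for the union
    over [s] and then over [r]. *)
Lemma sigma_fibre_discrete k A z e : sigma A -> cubeless A -> zero < e ->
  exists z' e', [/\ zero < e', cube z' e' `<=` cube z e &
    forall x, cube z' e' x -> discrete1 [set a | A (upd x k a)]].
Proof.
move=> [F [dF mF clF bF] ->] A0 e0.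
have dFrs r s : dfn (F r s).
  by apply: (definable_comp (h := fun x => (r, s, x)) dF); env_tac.
pose G r s x := has_interval [set a | F r s (upd x k a)].
have [zG|nz] := pselect (cube z e `<=` cl (family_union G)).
  have [|||r [s [z' [e' [s0 e'0 _ z'G]]]]] := @baire2 G _ _ z e e0 => //.
  - by rewrite /G /has_interval /=; definability.
  - move=> r r' s s' rr' ss' x [p [q [pq H]]]; exists p, q; split=> // y py yq.
    by apply: mF (H y py yq).
  have [u uE] := sub_ex r zero.
  case: (@fibre_has_interval n [set: 'I_n]%SET k (F r s) u _ _ _ _ _ _ z' e' e'0 z'G) => //.
  - exact: baireT.
  - by move=> x y; rewrite finset.setUT => /agreeT ->.
  - move=> x /bF /(_ k)[+ _]; rewrite -(leD2rE r u) (addC u) uE.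
    by [].
  - move=> w a a0 waF; apply: (A0 w a a0) => x /waF Fx; by exists r, s.
have [z' [e' [e'0 z'z z'G]]] := not_dense_cube e0 nz.
exists z', e'; split=> // x /z'G nG.
apply: (@discrete1_bigcup (fun r a => exists s, zero < s /\ F r s (upd x k a))).
- by definability.
- move=> r r'; wlog rr' : r r' / r <= r' => [hw|].
    by have [/hw|/ltW/hw[]] := leP r r'; [|right|left].
  by left=> a [s [s0 H]]; exists s; split=> //; apply: mF H.
- move=> r; apply: (@discrete1_bigcup (fun s a =>
  zero < s /\ F r s (upd x k a))).
  + by definability.
  + move=> s s'; wlog ss' : s s' / s <= s' => [hw|].
      by have [/hw|/ltW/hw[]] := leP s s'; [|right|left].
    have [s0|s0] := pselect (zero < s); last by left=> a [].
    by right=> a [_ H]; split=> //; apply: mF H.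
  + move=> s; have [s0|s0] := pselect (zero < s); last first.
      by move=> a; have [h h0] := pos_ex; exists h => // b [].
    apply: (discrete1S (Y := [set a | F r s (upd x k a)])) => [a []//|].
    by apply: fibre_discrete => // Grs; apply: nG; exists r, s.
Qed.

End Sigma.

(** * Points where a D_Sigma set is not locally closed *)

Lemma near_open2 e (x y : R) : near e x y ->
  exists2 h, zero < h & forall x' y', near h x x' -> near h y y' ->
    near e x' y'.
Proof.
move=> [xy yx]; have [g1 g1E] := sub_ex x (y [+] e).
have [g2 g2E] := sub_ex y (x [+] e).
have [||m0 m1 m2] := @min_pos g1 g2.
- by rewrite -(lt_addr x) g1E.
- by rewrite -(lt_addr y) g2E.
have H (a b a' b' g h : R) : a [+] g = b [+] e -> h [+] h <= g ->
    near h a a' -> near h b b' -> a' < b' [+] e.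
  move=> ab hg [_ aa'] [bb' _]; rewrite -(ltD2rE h).
  apply: lt_le_trans (_ : a [+] h [+] h <= _); first by rewrite ltD2rE.
  rewrite -addA; apply: le_trans (_ : a [+] g <= _); first by rewrite leD2lE.
  by rewrite ab -addA (addC e) addA leD2rE ltW.
have [h h0 hh] := half_ex m0; exists h => // x' y' xx' yy'; split.
  exact: (H x y x' y' g1 h g1E (le_trans hh m1)).
exact: (H y x y' x' g2 h g2E (le_trans hh m2)).
Qed.

Section Dimension.
Context {n : nat}.
Implicit Types (S : {set 'I_n}) (k : 'I_n) (A C E : set 'rV[R]_n).
Implicit Types (x z a b w : 'rV[R]_n).

Definition cube_on S z (e : R) : set 'rV[R]_n :=
  [set a | forall i, i \in S -> near e (z ord0 i) (a ord0 i)].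

(* On the part of E above the given cube of R^S, the coordinate k is a
   continuous function of the coordinates in S. *)
Definition continuous_coord S E z (e : R) k : Prop :=
  forall x, cube z e x -> forall h, zero < h -> exists2 t, zero < t &
    forall a b, E a -> E b -> cube_on S x t a -> cube_on S x t b ->
      near h (a ord0 k) (b ord0 k).

Lemma definable_cube_on {T} {cT : env R T} S (h h' : T -> 'rV[R]_n) (f : T ->
  R) :
  emap h -> emap f -> emap h' -> dfn (fun p => cube_on S (h p) (f p) (h' p)).
Proof. by move=> mh mf mh'; rewrite /cube_on /=; definability. Qed.

Lemma agree_cube_on S a x (t : R) : zero < t -> agree S a x -> cube_on S x t a.
Proof. by move=> t0 ax i iS; rewrite ax //; exact: near_refl. Qed.

Lemma cube_on_merge S a z (e : R) : zero < e -> cube_on S z e a ->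
  cube z e (merge S a z).
Proof.
by move=> e0 za i; rewrite mxE; case: ifPn => [/za//|_]; exact: near_refl.
Qed.

Lemma cube_on_le S z (e e' : R) : e <= e' -> cube_on S z e `<=` cube_on S z e'.
Proof. by move=> ee' a za i /za; exact: near_le. Qed.

Lemma cube_on_sub S z z' (e e' : R) : zero < e ->
  cube z e `<=` cube z' e' -> cube_on S z e `<=` cube_on S z' e'.
Proof.
move=> e0 zz' a /(cube_on_merge e0)/zz' H i iS.
by have := H i; rewrite mxE iS.
Qed.

Lemma proj_cube_on S E z (e : R) a : zero < e -> cube z e `<=` proj S E ->
  cube_on S z e a -> exists b, E b /\ agree S b a.
Proof.
move=> e0 zE /(cube_on_merge e0)/zE[b [Eb bm]]; exists b; split=> //.
exact: agree_trans bm (agree_merge _ _).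
Qed.

Lemma continuous_coord_sub S E E' z z' (e e' : R) k : E' `<=` E ->
  cube z' e' `<=` cube z e -> continuous_coord S E z e k ->
  continuous_coord S E' z' e' k.
Proof.
move=> EE' zz' Ec x /zz' zx h h0; have [t t0 tP] := Ec x zx h h0.
by exists t => // a b /EE' Ea /EE' Eb; exact: tP.
Qed.

Lemma continuous_coord_in S E z (e : R) k : k \in S ->
  continuous_coord S E z e k.
Proof.
move=> kS x _ h /half_ex[t t0 th];
  exists t => // a b _ _ /(_ k kS) xa /(_ k kS) xb.
apply: near_le th _; exact: near_trans (near_sym xa) xb.
Qed.

(** * Continuous selection of lowest points *)

Section Select.
Variables (S : {set 'I_n}) (E : set 'rV[R]_n) (r : R).
Hypotheses (dE : dfn E) (clE : cl E `<=` E) (Er : E `<=` box r).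

Definition lowest k : set 'rV[R]_n :=
  [set a | E a /\ forall b, E b -> agree S b a -> a ord0 k <= b ord0 k].

Lemma box_lower : exists u, forall a k, E a -> u <= a ord0 k.
Proof.
have [u uE] := sub_ex r zero; exists u => a k /Er /(_ k)[+ _].
by rewrite -(leD2rE r u) (addC u) uE.
Qed.

Lemma lowest_ex k x : k \notin S -> proj S E x -> exists2 a, lowest k a &
  agree S a x.
Proof.
move=> kS [a0 [Ea0 a0x]]; have [u Eu] := box_lower.
pose Y y := exists a, [/\ E a, agree S a x & a ord0 k = y].
have [|||m [Ym _ mY]] := @inf_ex Y u.
- by rewrite /Y; definability.
- by exists (a0 ord0 k), a0.
- by move=> _ [a [Ea _ <-]]; exact: Eu.
have [a [Ea ax]] : proj (k |: S) E (upd x k m).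
  apply: (cl_proj_box dE clE Er) => h h0;
    have [y [[a [Ea ax ay]] _ my]] := mY h h0.
  exists (upd x k y); split; first exact: cube_upd (cube_refl x h0) my.
  exists a; split=> // i; rewrite !inE mxE; case: eqP => [->|_ /= /ax] //.
have {}ax' : agree S a x.
  move=> i iS; rewrite (ax i) ?inE ?iS ?orbT // mxE.
  by case: eqP => // ik; rewrite ik (negbTE kS) in iS.
exists a => //; split=> // b Eb ba; rewrite (ax k) ?setU11 // updE.
by apply: Ym; exists b; split=> //; exact: agree_trans ax'.
Qed.

(** The closed sets [D p], the projections of the part of [E] at height at most [p], increase with
    [p], and the least height over a point is the first [p] for which [D p] contains it. So
    [baire_localize] confines this height between [c0] and [c]. *)
Lemma lowest_oscillation k z e h : zero < e -> zero < h ->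
  cube z e `<=` proj S E ->
  exists z' e', [/\ zero < e', cube z' e' `<=` cube z e &
    forall a b, lowest k a -> lowest k b -> cube_on S z' e' a ->
      cube_on S z' e' b -> near h (a ord0 k) (b ord0 k)].
Proof.
move=> e0 h0 zE; have [u Eu] := box_lower.
pose D p := proj S (E `&` [set a | a ord0 k <= p]).
have dEp p : dfn (E `&` [set a | a ord0 k <= p]) by rewrite /setI /=;
  definability.
have clD p : cl (D p) `<=` D p.
  apply: (cl_proj_box (dEp p) (r := r)); last by move=> a [/Er].
  apply: clI => // a aH; rewrite /= leNgt; apply/negP => pa.
  have [_ [v /andP[_ av]]] := R_noends (a ord0 k).
  have [t t0 tP] := near_itv pa av; have [b [ab /=]] := aH t t0.
  by rewrite leNgt (tP _ (ab k)).1.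
have [||||| c0 [c [z' [e' [[c0c nc0c] [e'0 z'z z'D] Dc0]]]]] :=
  @baire_localize n S D u (@baireT n S) _ _ _ _ z e h e0 h0.
- by rewrite /D /proj /setI /=; definability.
- move=> p q pq; apply: projS => a [Ea /= ap]; split=> //=; exact: le_trans pq.
- by move=> p; exact: proj_cylinder.
- by move=> p x [a [[/Eu ua /= ap] _]]; exact: le_trans (ua k) ap.
- move=> x /zE[a [Ea ax]]; apply: subset_cl; exists (a ord0 k), a.
  by split=> //; split=> //=.
exists z', e'; split=> //.
have H a : lowest k a -> cube_on S z' e' a ->
  (c0 <= a ord0 k) /\ (a ord0 k <= c).
  move=> [Ea amin] /(cube_on_merge e'0) za; split.
    rewrite leNgt; apply/negP => ac0; apply: (Dc0 _ _ ac0 za).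
    by exists a; split; [split=> //=|exact/agree_sym/agree_merge].
  have [b [[Eb /= bc] bm]] := clD _ _ (z'D _ za).
  apply: le_trans bc; apply: amin => //;
    exact: agree_trans bm (agree_merge _ _).
move=> a b /H{}H1 /H{}H2 /H1[a1 a2] /H2[b1 b2].
exact: (near_between nc0c).
Qed.

Lemma select_coord k z e : k \notin S -> zero < e -> cube z e `<=` proj S E ->
  exists E' z' e', [/\ [/\ dfn E', cl E' `<=` E' & E' `<=` E],
    [/\ zero < e', cube z' e' `<=` cube z e & cube z' e' `<=` proj S E'] &
    continuous_coord S E' z' e' k].
Proof.
move=> kS e0 zE; have dL : dfn (lowest k) by rewrite /lowest /=; definability.
pose good h x := exists t, zero < t /\ forall a b, lowest k a -> lowest k b ->
  cube_on S x t a -> cube_on S x t b -> near h (a ord0 k) (b ord0 k).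
(* [bad h] shrinks as [h] grows. If discontinuities were dense, [baireT] would make those of one
   fixed size [h] dense in a cube, against [lowest_oscillation]. *)
pose bad h x := zero < h /\ ~ good h x.
have [zb|/not_dense_cube] := pselect (cube z e `<=` cl [set x | exists h,
  bad h x]).
  have [|||h [z1 [e1 [e10 z1z z1b]]]] :=
    @baireT n [set: 'I_n]%SET bad _ _ _ z e e0 zb.
  - by rewrite /bad /good /cube_on /=; definability.
  - move=> t t'; wlog tt' : t t' / t <= t' => [hw|].
      by have [/hw|/ltW/hw[]] := leP t t'; [|right|left].
    have [t0|nt0] := pselect (zero < t); last by left=> x [].
    right=> x [_ ng]; split=> // -[s [s0 sP]]; apply: ng; exists s;
      split=> // a b.
    move=> la lb xa xb; exact: near_le tt' (sP a b la lb xa xb).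
  - by move=> t x y /agreeT ->.
  have h0 : zero < h by have [x [_ []]] := z1b z1 (cube_refl z1 e10) e1 e10.
  have [z2 [e2 [e20 z2z1 z2P]]] :=
    lowest_oscillation k e10 h0 (subset_trans z1z zE).
  have [x [z2x _ [_ ng]]] :=
    cl_cube (subset_trans z2z1 z1b) (cube_refl z2 e20) e20.
  case: ng; have [t t0 tP] := cube_open z2x; exists t;
    split=> // a b la lb xa xb.
  by apply: z2P => //; exact: (cube_on_sub t0 tP).
move=> /(_ e0)[z1 [e1 [e10 z1z z1g]]].
have Lc : continuous_coord S (lowest k) z1 e1 k.
  move=> x /z1g ng h h0; have [t [t0 tP]] : good h x.
    by apply: contrapT => H; apply: ng; exists h.
  by exists t.
have [h h0 hhe] := half_ex e10.
have he : h < e1 by apply: lt_le_trans hhe; rewrite lt_addr.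
pose E' := lowest k `&` [set a | forall i, i \in S ->
  nearc h (z1 ord0 i) (a ord0 i)].
exists E', z1, h; split; [split|split=> //|].
- by apply: definable_and => //=; definability.
(* A limit [a] of lowest points is lowest: by continuity its coordinate [k] agrees with that of the
   lowest point [b0] over the same base point. Restricting to radius [h < e1] keeps that base point
   inside the cube of continuity. *)
- move=> a aE'; have Ea : E a by apply/clE/(clS _ aE') => b [[]].
  have za i : i \in S -> nearc h (z1 ord0 i) (a ord0 i).
    move=> iS; apply: contrapT => /nearc_closed[t t0 tP].
    have [b [ab [_ /(_ i iS)]]] := aE' t t0.
    by apply: tP => //; exact: near_refl.
  split=> //; split=> // b Eb ba; have [||b0 lb0 b0b] := @lowest_ex k b => //.
    by exists b.
  apply: le_trans (_ : b0 ord0 k <= _); last by apply: lb0.2 => //;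
    exact: agree_sym.
  suff -> : a ord0 k = b0 ord0 k by [].
  have z1a : cube z1 e1 (merge S a z1).
    by apply: cube_on_merge => // i /za; exact: nearc_near.
  apply: near_eq => t /half_ex[s s0 st]; have [v v0 vP] := Lc _ z1a s s0.
  have [m0 ms mv] := min_pos s0 v0; have [a' [aa' [la' _]]] := aE' _ m0.
  apply: near_le st _; apply: near_trans (near_le ms (aa' k)) _.
  apply: vP => // i iS; rewrite mxE iS.
    exact: near_le mv (aa' i).
  by rewrite b0b // ba //; exact: near_refl.
- by move=> a [[]].
- by apply: subset_trans z1z; exact/cube_le/ltW.
- move=> x zx; have [|a la ax] := @lowest_ex k x kS.
    by apply/zE/z1z/(cube_le (ltW he)).
  exists a; split=> //; split=> // i iS; rewrite /= ax //; exact: near_nearc.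
- apply: continuous_coord_sub Lc; first by move=> a [].
  exact/cube_le/ltW.
Qed.

End Select.

(** Minimising one coordinate leaves the others free, hence the iteration; continuity already gained
    survives passing to smaller sets and cubes. *)
Lemma select_seq S E r z e (l : seq 'I_n) : dfn E -> cl E `<=` E ->
  E `<=` box r ->
  zero < e -> cube z e `<=` proj S E ->
  exists E' z' e', [/\ [/\ dfn E', cl E' `<=` E' & E' `<=` E],
    [/\ zero < e', cube z' e' `<=` cube z e & cube z' e' `<=` proj S E'] &
    forall k, k \in l -> continuous_coord S E' z' e' k].
Proof.
move=> dE clE Er e0 zE.
elim: l => [|k s [E1 [z1 [e1 [[dE1 clE1 E1E] [e10 z1z z1E1] cE1]]]]].
  by exists E, z, e; split; [split|split|].
have [kS|kS] := boolP (k \in S).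
  exists E1, z1, e1; split=> // j; rewrite inE => /orP[/eqP ->|/cE1//].
  exact: continuous_coord_in.
have [E2 [z2 [e2 [[dE2 clE2 E2E1] [e20 z2z1 z2E2] cE2]]]] :=
  @select_coord S E1 r dE1 clE1 (subset_trans E1E Er) k z1 e1 kS e10 z1E1.
exists E2, z2, e2; split; [split=> //; exact: subset_trans E1E|split=> //|].
  exact: subset_trans z1z.
move=> j; rewrite inE => /orP[/eqP ->//|/cE1]; exact: continuous_coord_sub.
Qed.


Lemma continuous_coord_all S E z e x h :
  (forall k, continuous_coord S E z e k) -> cube z e x -> zero < h ->
  exists2 t, zero < t & forall a b, E a -> E b ->
    cube_on S x t a -> cube_on S x t b -> cube a h b.
Proof.
move=> Ec zx h0.
have [||t t0 tP] := @fin_pos _ (fun k t => forall a b, E a -> E b ->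
    cube_on S x t a -> cube_on S x t b -> near h (a ord0 k) (b ord0 k)).
- move=> k t t' tt' H a b Ea Eb xa xb.
  by apply: H => //; exact: cube_on_le tt' _ _.
- by move=> k; exact: Ec.
- by exists t => // a b Ea Eb xa xb k; exact: tP.
Qed.

Lemma cube_eq a b : (forall h, zero < h -> cube a h b) -> a = b.
Proof. by move=> ab; apply/rowP => i; apply: near_eq => h /ab. Qed.

Lemma continuous_coord_unique S E z e x a b :
  (forall k, continuous_coord S E z e k) -> cube z e x ->
  E a -> E b -> agree S a x -> agree S b x -> a = b.
Proof.
move=> Ec zx Ea Eb ax bx; apply: cube_eq => h h0.
have [t t0 tP] := continuous_coord_all Ec zx h0.
by apply: tP => //; exact: agree_cube_on.
Qed.

(* In terms of the dimension described at the top, [small m A] is dim A < m. *)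
Definition small (m : nat) A : Prop := forall S, #|S| = m ->
  cubeless (proj S A).

(** Adding [k] to [S] gives [m.+1] coordinates, so smallness says that [proj (k |: S) A] has no
    interior and [sigma_fibre_discrete] applies; the cube shrinks once for each [k]. *)
Lemma small_fibres_discrete m A S z e (l : seq 'I_n) : sigma A ->
  small m.+1 A ->
  #|S| = m -> zero < e ->
  exists z' e', [/\ zero < e', cube z' e' `<=` cube z e &
    forall k, k \in l -> k \notin S -> forall x, cube z' e' x ->
      discrete1 [set a | proj (k |: S) A (upd x k a)]].
Proof.
move=> sA A0 Sm e0; elim: l => [|k l [z1 [e1 [e10 z1z H]]]].
  by exists z, e; split.
have [kS|kS] := boolP (k \in S).
  exists z1, e1; split=> // j; rewrite inE => /orP[/eqP ->|/H//].
  by rewrite kS.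
have [||z2 [e2 [e20 z2z1 H2]]] :=
  @sigma_fibre_discrete n k (proj (k |: S) A) z1 e1 _ _ e10.
- exact: sigma_proj.
- by apply: A0; rewrite cardsU1 kS Sm.
exists z2, e2; split=> //; first exact: subset_trans z1z.
move=> j; rewrite inE => /orP[/eqP -> _|jl jS x z2x]; first exact: H2.
exact: (H j jl jS _ (z2z1 _ z2x)).
Qed.

(** When [E] is a graph over the cube of R^S, this is its tube of radius [t] with the graph itself
    removed. *)
Definition off_graph S E z (e t : R) : set 'rV[R]_n :=
  [set a | cube_on S z e a /\ exists b, [/\ E b, agree S b a &
    cube b t a /\ a <> b]].

Lemma definable_off_graph {T} {cT : env R T} S E z e (f : T -> R)
    (h : T -> 'rV[R]_n) : dfn E -> emap f -> emap h ->
  dfn (fun p => off_graph S E z e (f p) (h p)).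
Proof.
move=> dE mf mh.
have dO : dfn (fun q : R * 'rV[R]_n => off_graph S E z e q.1 q.2).
  rewrite /off_graph /=; apply: definable_and.
    by apply: definable_cube_on; env_tac.
  apply: (definable_ex_row zero); apply: definable_and3; [by definability..|].
  apply: definable_and; first by definability.
  (* Equality of rows has to be spelled out by coordinates, as [definable_eq] compares elements of
     [R]. *)
  apply: (@definable_ext _ _ _ _ _ (fun p : R * 'rV[R]_n * 'rV[R]_n =>
    ~ forall i, p.1.2 ord0 i = p.2 ord0 i)) => [p|]; last by definability.
  by split=> H /= H'; apply: H; [rewrite H'|apply/rowP].
exact: (definable_app2 dO).
Qed.

(** Continuity of [E] is essential: when [a] moves slightly, so does the point [b] of [E] over it,
    and both the bound [t] and the inequality of [a] and [b] persist. *)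
Lemma off_graph_open S E z e t : zero < e -> cube z e `<=` proj S E ->
  (forall k, continuous_coord S E z e k) ->
  cl (~` off_graph S E z e t) `<=` ~` off_graph S E z e t.
Proof.
move=> e0 zE Ec a aO [za [b [Eb ba [bta ab]]]].
have zx := cube_on_merge e0 za.
have [g g0 gab] : exists2 g, zero < g & ~ cube a g b.
  apply: contrapT => H; apply: ab; apply: cube_eq => h h0.
  by apply: contrapT => nab; apply: H; exists h.
have [h1 h10 h1g] := half_ex g0.
have [h2 h20 h2P] : exists2 h, zero < h & forall a' b', cube a h a' ->
  cube b h b' ->
    cube b' t a'.
  have [||h h0 hP] := @fin_pos _ (fun i h => forall a' b' : R,
    near h (a ord0 i) a' ->
    near h (b ord0 i) b' -> near t b' a').
  - by move=> i h h' hh' H a' b' /(near_le hh') aa' /(near_le hh'); exact: H.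
  - move=> i; have [h h0 hP] := near_open2 (bta i).
    by exists h => // a' b' aa' bb'; exact: hP.
  - by exists h => // a' b' aa' bb' i; exact: hP.
have [m0 m1 m2] := min_pos h10 h20.
have [s s0 sP] := continuous_coord_all Ec zx m0.
have [c c0 cz] : exists2 c, zero < c & forall a', cube a c a' ->
  cube_on S z e a'.
  have [c c0 cP] := cube_open zx; exists c => // a' aa'.
  have : cube z e (merge S a' z).
    apply: cP => i; rewrite !mxE; case: ifP => _; first exact: aa'.
    exact: near_refl.
  by move=> H i iS; have := H i; rewrite mxE iS.
have [n0 nm ns] := min_pos m0 s0; have [l0 ln lc] := min_pos n0 c0.
have [a' [aa' nO]] := aO _ l0; apply: nO.
have za' : cube_on S z e a' by apply: cz; exact: cube_le lc _ aa'.
have [b' [Eb' b'a']] := proj_cube_on e0 zE za'.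
have bb' : cube b (Order.min h1 h2) b'.
  apply: sP => // i iS; rewrite mxE iS; first by rewrite ba //;
    exact: near_refl.
  by rewrite b'a' //; exact: near_le (le_trans ln ns) (aa' i).
split=> //; exists b'; split=> //; split.
  apply: h2P; last exact: cube_le bb'.
  exact: cube_le (le_trans ln (le_trans nm m2)) _ aa'.
move=> a'b'; apply: gab; apply: cube_le h1g _ _.
apply: cube_trans (cube_le (le_trans ln (le_trans nm m1)) aa') _.
by rewrite a'b'; apply: cube_sym; exact: cube_le bb'.
Qed.

(* If the projection of [A `&` cl (cl A `\` A)] contained a cube, then we could
   select a continuous section E of A above a cube. The fibres of A are
   discrete there, so by [baireT] they have no point at distance less than t
   from E except the points of E, for some fixed t and above some smaller cube.
   Hence A is closed near each point of E. *)
Lemma small_not_locally_closed m A : sigma A -> small m.+1 A ->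
  small m (A `&` cl (cl A `\` A)).
Proof.
move=> sA A0 S Sm z e e0 zA1.
have dA := definable_sigma sA.
set A1 := A `&` cl (cl A `\` A) in zA1.
have sA1 : sigma A1.
  apply: sigmaI => //; apply: sigma_closed; last exact: cl_cl.
  by rewrite /setD /=; definability.
have [z1 [e1 [e10 z1z A1d]]] := small_fibres_discrete z (enum 'I_n) sA A0 Sm e0.
have {}A1d k : k \notin S -> forall x, cube z1 e1 x ->
    discrete1 [set a | proj (k |: S) A (upd x k a)].
  by apply: A1d; rewrite mem_enum.
have [F sF A1F] := sA1; have [dF mF clF bF] := sF.
have [|r [s [z2 [e2 [s0 e20 z2z1 z2F]]]]] :=
    sigma_family_baire (z := z1) (sigma_family_proj S sF) e10.
  rewrite -family_union_proj // -A1F; apply: subset_trans (@subset_cl _ _).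
  exact: subset_trans zA1.
have [||E [z3 [e3 [[dE clE EF] [e30 z3z2 z3E] Ec']]]] :=
    @select_seq S (F r s) r z2 e2 (enum 'I_n) _ (clF r s) (bF r s) e20 _.
- by apply: (definable_comp (h := fun x => (r, s, x)) dF); env_tac.
- by move=> x /z2F[].
have Ec k : continuous_coord S E z3 e3 k by apply: Ec'; rewrite mem_enum.
have EA1 : E `<=` A1 by move=> a /EF Fa; rewrite A1F; exists r, s.
pose Q t := proj S (A `&` off_graph S E z3 e3 t).
have sQ t : sigma (Q t).
  apply/sigma_proj/sigmaI => //; apply: sigma_open.
    by apply: definable_off_graph => //; env_tac.
  exact: off_graph_open.
pose X t x := zero < t /\ ~ Q t x.
have Qle t t' : t <= t' -> Q t `<=` Q t'.
  move=> tt'; apply: projS => a [Aa [za [b [Eb ba [bta ab]]]]]; split=> //;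
    split=> //.
  by exists b; split=> //; split=> //; exact: cube_le bta.
have [||||t [z4 [e4 [e40 z4z3 z4X]]]] :=
    @baireT n [set: 'I_n]%SET X _ _ _ z3 e3 e30.
- rewrite /X; apply: definable_and; first by definability.
  apply: definable_not; rewrite /Q /proj /=; apply: (definable_ex_row zero).
  apply: definable_and; last by definability.
  apply: definable_and; first by definability.
  by apply: definable_off_graph => //; env_tac.
- move=> t t'; wlog tt' : t t' / t <= t' => [hw|].
    by have [/hw|/ltW/hw[]] := leP t t'; [|right|left].
  have [t0|t0] := pselect (zero < t); last by left=> x [].
  by right=> x [_ H]; split=> // /(Qle _ _ tt').
- by move=> t x y /agreeT ->.
(* A point of [A] over [x] other than [b] differs from it in some coordinate [k] outside [S], and
   the projection to [k |: S] isolates [b] there. The least of these radii is a [t] for which [x] is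
   not in [Q t]. *)
- move=> x z3x; apply: subset_cl.
  have [b [Eb bx]] := z3E x z3x; have [[Ab _]] := (EA1 b Eb, tt).
  have [||t t0 tP] := @fin_pos _ (fun k t => k \notin S -> forall y,
      proj (k |: S) A (upd x k y) -> near t (b ord0 k) y -> y = b ord0 k).
  + by move=> k t t' tt' H kS y Ay /(near_le tt'); exact: H.
  + move=> k; have [kS|kS] := boolP (k \in S); first by have [t t0] := pos_ex;
    exists t.
    have [t t0 tP] := A1d k kS x (z2z1 _ (z3z2 _ z3x)) (b ord0 k).
    by exists t => // _ y; exact: tP.
  exists t; split=> // -[a [[Aa [_ [b' [Eb' b'a [b'ta ab']]]]] ax]]; apply: ab'.
  have b'b : b' = b.
    apply: (continuous_coord_unique Ec z3x) => //; exact: agree_trans ax.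
  apply/rowP => k; rewrite b'b; have [kS|kS] := boolP (k \in S).
    by rewrite ax // bx.
  apply: (tP k) => //; last by rewrite -b'b; exact: b'ta.
  exists a; split=> // i; rewrite !inE mxE.
  by case: eqP => [->//|_ /= /ax].
have t0 : zero < t by have [x [_ []]] := z4X z4 (cube_refl z4 e40) e4 e40.
(* [Q t] misses a dense set, and being [sigma] it then misses a whole cube: over that cube the only
   points of [A] within [t] of [E] are those of [E]. *)
have [z5 [e5 [e50 z5z4 z5M]]] := sigma_dichotomy z4 (sQ t) e40.
case: z5M => z5M.
  have [x [z5x _ [_ nQ]]] :=
    cl_cube (subset_trans z5z4 z4X) (cube_refl z5 e50) e50.
  exact: nQ (z5M x z5x).
have z5z3 := subset_trans z5z4 z4z3.
have [b [Eb bz5]] := z3E z5 (z5z3 _ (cube_refl z5 e50)).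
have [Ab bcl] := EA1 b Eb.
have [h h0 ht] := half_ex t0.
have [g g0 gP] := continuous_coord_all Ec (z5z3 _ (cube_refl z5 e50)) h0.
have [m0 mh mg] := min_pos h0 g0; have [n0 nm ne] := min_pos m0 e50.
(* Points [a] of [A] close to [w] are within [t] of the point [b'] of [E] over them, one [h]
   accounting for [b'] to [b] and another for [b] to [a]. So they lie on [E], and [w] lies in its
   closure, hence in [A]. *)
have [w [bw [wA nAw]]] := bcl _ n0.
apply: nAw; suff /EA1[] : E w by [].
apply: clE => c c0; have [v v0 vP] := cube_open bw.
have [l0 lc lv] := min_pos c0 v0; have [a [wa Aa]] := wA _ l0.
have ba : cube b (Order.min (Order.min h g) e5) a by apply: vP;
  exact: cube_le lv _ wa.
have z5a : cube_on S z5 e5 a.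
  by move=> i iS; rewrite -bz5 //; exact: near_le ne (ba i).
have z5x := cube_on_merge e50 z5a.
have z3a : cube_on S z3 e3 a by exact: (cube_on_sub e50 z5z3).
have [b' [Eb' b'a]] := proj_cube_on e30 z3E z3a.
have bb' : cube b h b'.
  apply: gP => //; first exact: agree_cube_on.
  by move=> i iS; rewrite b'a // -bz5 //;
    exact: near_le (le_trans nm mg) (ba i).
have [ab'|ab'] := pselect (a = b').
  by exists a; split; [exact: cube_le lc _ wa|rewrite ab'].
case: (z5M _ z5x); exists a; split; last exact/agree_sym/agree_merge.
split=> //; split=> //; exists b'; split=> //; split=> //.
apply: cube_le ht _ _; apply: cube_trans (cube_sym bb') _.
exact: cube_le (le_trans nm mh) _ ba.
Qed.

End Dimension.

(** * The open core *)

Lemma nbhs_cubeP n (z : 'rV[R]_n) (A : set 'rV[R]_n) :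
  nbhs z A <-> exists2 e, zero < e & cube z e `<=` A.
Proof.
split=> [[P zP PA]|[e e0 eA]].
  have [||e e0 eP] := @fin_pos _ (fun i e => forall y, near e (z ord0 i) y ->
    P ord0 i y).
  - by move=> i e e' ee' H y /(near_le ee') /H.
  - by move=> i; have /nbhs_nearP[e e0 eP] := zP ord0 i; exists e.
  - by exists e => // x zx; apply: PA => i j; rewrite (ord1 i); exact/eP/zx.
exists (fun _ j => [set y | near e (z ord0 j) y]).
  by move=> i j; apply/nbhs_nearP; exists e => // y; rewrite (ord1 i).
by move=> x /= zx; apply: eA => j; exact: zx.
Qed.

Lemma open_clP n (U : set 'rV[R]_n) : open U <-> cl (~` U) `<=` ~` U.
Proof.
rewrite openE; split=> [oU x xU Ux|clU x Ux].
  have /nbhs_cubeP[e e0 eU] := oU x Ux.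
  by have [y [xy nUy]] := xU e e0; exact/nUy/eU.
apply/nbhs_cubeP; apply: contrapT => H; apply: (clU x) => // e e0.
apply: contrapT => nE; apply: H; exists e => // y xy.
by apply: contrapT => nUy; apply: nE; exists y.
Qed.

(** The open sets are required to be definable, so that such a combination is again [sigma]. *)
Inductive definably_constructible n : set 'rV[R]_n -> Prop :=
| definably_constructible_open U :
    dfn U -> open U -> definably_constructible U
| definably_constructibleC A :
    definably_constructible A -> definably_constructible (~` A)
| definably_constructibleU A B :
    definably_constructible A -> definably_constructible B ->
    definably_constructible (A `|` B).

(** * D_Sigma sets as boolean combinations of definable open sets *)

Section Constructible.
Context {n : nat}.
Implicit Types (A B C : set 'rV[R]_n).

Lemma definably_constructibleI A B : definably_constructible A ->
  definably_constructible B -> definably_constructible (A `&` B).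
Proof.
move=> /definably_constructibleC cA /definably_constructibleC cB.
by rewrite -(setCK (A `&` B)%classic) setCI;
  exact/definably_constructibleC/definably_constructibleU.
Qed.

Lemma definably_constructible_closed C : dfn C -> cl C `<=` C ->
  definably_constructible C.
Proof.
move=> dC clC; rewrite -(setCK C); apply/definably_constructibleC.
apply: definably_constructible_open; last by apply/open_clP; rewrite setCK.
exact: definable_not.
Qed.

(** Both conclusions are proved at once because the complement step exchanges them. *)
Lemma definably_constructible_sigma A :
  definably_constructible A -> sigma A /\ sigma (~` A).
Proof.
elim=> [U dU /open_clP oU|{}A _ [sA sCA]|{}A B _ [sA sCA] _ [sB sCB]].
- split; first exact: sigma_open.
  by apply: sigma_closed => //; exact: definable_not.
- by rewrite setCK.
- by rewrite setCU; split; [exact: sigmaU|exact: sigmaI].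
Qed.

Lemma definably_constructible_constructible A :
  definably_constructible A -> constructible A.
Proof.
elim=> [U _ oU|B _ cB|B B' _ cB _ cB'].
- exact: constructible_open.
- exact: constructibleC.
- exact: constructibleU.
Qed.

Lemma sigma_definably_constructible A : sigma A -> definably_constructible A.
Proof.
(* The induction starts vacuously, no set of coordinates having [n.+1] elements. It ends at zero,
   where a point of [A] would make the projection to no coordinates the whole space. *)
move=> sA; have : small n.+1 A.
  by move=> S Sn; have := max_card (mem S); rewrite Sn card_ord ltnn.
elim: n.+1 A sA => [|m IH] A sA A0.
  suff -> : A = set0 by apply: definably_constructible_open;
    [exact: (definable_cst _ zero)|exact: open0].
  apply/seteqP; split=> // a Aa; have [e e0] := pos_ex.
  apply: (A0 finset.set0 (cards0 _) a e e0) => x _.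
  by exists a; split=> // i; rewrite inE.
have dA := definable_sigma sA.
have dD : dfn (cl (cl A `\` A)) by rewrite /setD /=; definability.
have cA1 : definably_constructible (A `&` cl (cl A `\` A)).
  apply: IH; last exact: small_not_locally_closed.
  by apply: sigmaI => //; apply: sigma_closed => //; exact: cl_cl.
(* The first piece is a closed set minus a closed set; the second has smaller dimension. *)
have -> : A = ((cl A `&` ~` cl (cl A `\` A)) `|` (A `&` cl (cl A `\` A)))%classic.
  apply/seteqP; split=> x.
    have [xD|xD] := pselect (cl (cl A `\` A) x); first by right.
    by move=> Ax; left; split=> //; exact: subset_cl.
  move=> [[xA xD]|[]//]; apply: contrapT => nAx; apply: xD.
  by apply: subset_cl.
apply: definably_constructibleU => //; apply: definably_constructibleI.
  by apply: definably_constructible_closed; [definability|exact: cl_cl].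
apply: definably_constructibleC; apply: definably_constructible_closed => //.
exact: cl_cl.
Qed.

End Constructible.

Section ConsRow.
Context {n : nat}.

Lemma env_map_cons_row E {cE : env R E} (f : E -> R) (h : E -> 'rV[R]_n) :
  emap f -> emap h -> emap (fun p => cons_row (f p) (h p)).
Proof.
by move=> mf mh; apply: env_map_row => i; case: unliftP => [j|] _; env_tac.
Qed.

Lemma cube_cons_row (x x' : 'rV[R]_n) y y' h : cube x h x' -> near h y y' ->
  cube (cons_row y x) h (cons_row y' x').
Proof.
by move=> xx' yy' i; rewrite !mxE; case: unliftP => [j|].
Qed.

(** The quantifier step, and the reason for passing through [sigma]: the bound [r] confines the
    quantified coordinate to a segment, so the projected family is still closed. *)
Lemma definably_constructible_ex (A : set 'rV[R]_n.+1) :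
  definably_constructible A ->
  definably_constructible [set x : 'rV[R]_n | exists a, A (cons_row a x)].
Proof.
move=> /definably_constructible_sigma[[F [dF mF clF bF] ->] _].
apply: sigma_definably_constructible.
have box_cons r a (x : 'rV[R]_n) : box r (cons_row a x) ->
  nearc r zero a /\ box r x.
  move=> H; split=> [|i]; first by have := H ord0; rewrite mxE unlift_none.
  by have := H (lift ord0 i); rewrite mxE liftK.
exists (fun r s => [set x : 'rV[R]_n | exists a, F r s (cons_row a x)]).
  split.
  - rewrite /=; apply: (definable_ex zero).
    apply: (definable_comp (h := fun q : R * R * 'rV[R]_n * R =>
      (q.1.1.1, q.1.1.2, cons_row q.2 q.1.2)) dF).
    by apply: env_map_pair; [env_tac|apply: env_map_cons_row; env_tac].
  - by move=> r r' s s' rr' ss' x [a Fa]; exists a; exact: mF Fa.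
  - move=> r s; have [p pE] := sub_ex r zero.
    have -> : [set x : 'rV[R]_n | exists a, F r s (cons_row a x)] =
        [set x | exists a, [/\ p <= a, a <= r & F r s (cons_row a x)]].
      apply/seteqP; split=> x [a]; last by case; exists a.
      move=> Fa; exists a; have [[ra ar] _] := box_cons _ _ _ (bF _ _ _ Fa).
      split=> //; last by move: ar; rewrite add0.
      by rewrite -(leD2rE r) (addC p) pE.
    apply: (cl_proj (f := fun x a => cons_row a x)) => //.
    + by apply: env_map_cons_row; env_tac.
    + by move=> x x' y y' h; exact: cube_cons_row.
    + by apply: (definable_comp (h := fun x => (r, s, x)) dF); env_tac.
  - by move=> r s x [a /bF/box_cons[]].
apply/seteqP; split=> x.
  by move=> [a [r [s [s0 Fa]]]]; exists r, s; split=> //; exists a.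
by move=> [r [s [s0 [a Fa]]]]; exists a, r, s.
Qed.

End ConsRow.

Section OpenCore.
Local Notation O := (open_core N).

Lemma open_core_term (t : term (open_core_language N)) :
  exists i, forall v, Defs.eval O v t = v i.
Proof. by case: t => [i|[]]; exists i. Qed.

Lemma row_cat_ord n (x : 'rV[R]_n) v (i : 'I_n) : row_cat x v i = x ord0 i.
Proof. by rewrite /row_cat valK. Qed.

Lemma row_cat_ge n (x : 'rV[R]_n) v i : (n <= i)%N -> row_cat x v i = v (i - n).
Proof. by move=> ni; rewrite /row_cat insubN // -leqNgt. Qed.

Lemma near_row_cat n (x y : 'rV[R]_n) v i h : zero < h -> cube x h y ->
  near h (row_cat x v i) (row_cat y v i).
Proof.
move=> h0 xy; have [ni|ni] := ltnP i n; last first.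
  by rewrite !row_cat_ge //; exact: near_refl.
by rewrite -[i]/(val (Ordinal ni)) !row_cat_ord.
Qed.

Lemma env_map_row_cat n v i : emap (fun x : 'rV[R]_n => row_cat x v i).
Proof.
have [ni|ni] := ltnP i n.
  by rewrite -[i]/(val (Ordinal ni)); under eq_fun do rewrite row_cat_ord;
    env_tac.
by under eq_fun do rewrite row_cat_ge //; env_tac.
Qed.

Lemma scons_row_cat n (x : 'rV[R]_n) v a :
  scons a (row_cat x v) = row_cat (cons_row a x) v.
Proof.
apply/funext => -[|i] /=.
  by rewrite -[0]/(val (@ord0 n)) row_cat_ord mxE unlift_none.
have [ni|ni] := ltnP i n; last by rewrite !row_cat_ge // subSS.
rewrite -[i.+1]/(val (lift ord0 (Ordinal ni))) row_cat_ord mxE liftK.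
exact: (row_cat_ord x v (Ordinal ni)).
Qed.

(** Without function symbols every term is a variable, so an equality gives a closed set and a
    relation the preimage of an open set. The number [n] varies in the induction because a
    quantifier adds a coordinate. *)
Lemma open_core_constructible n (X : set 'rV[R]_n) :
  definable O X -> definably_constructible X.
Proof.
move=> [phi [v ->]]; elim: phi n {X} => [t u|r ts|p IH|p IHp q IHq|p IH] n /=.
- have [i tE] := open_core_term t; have [j uE] := open_core_term u.
  under eq_set do rewrite tE uE.
  apply: definably_constructible_closed.
    by apply: definable_eq; exact: env_map_row_cat.
  move=> x xX; apply: near_eq => e e0; have [h h0 hh] := half_ex e0.
  have [y [xy /= yX]] := xX h h0; apply: near_le hh _.
  apply: near_trans (near_row_cat v i h0 xy) _; rewrite yX.
  exact/near_sym/near_row_cat.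
- case: r ts => [m [U [m0 oU dU]]] /= ts.
  have /choice[f fE] i := open_core_term (ts i).
  under eq_set => x do under eq_mx do rewrite fE.
  move/(definable_onE _ zero): dU => dU.
  apply: definably_constructible_open.
    apply: (definable_comp (h := fun x : 'rV[R]_n =>
      \row_i row_cat x v (f i))%R dU).
    by apply: env_map_row => i; exact: env_map_row_cat.
  apply/open_clP => x xU /= Ux; have /open_clP clU := oU.
  apply: (clU _ _ Ux) => h h0; have [y [xy nUy]] := xU h h0.
  exists (\row_i row_cat y v (f i))%R; split=> // i; rewrite !mxE.
  exact: near_row_cat.
- exact/definably_constructibleC/IH.
- exact: definably_constructibleI.
- under eq_set => x do under eq_exists => a do rewrite scons_row_cat.
  exact: (definably_constructible_ex (IH n.+1)).
Qed.

End OpenCore.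

(** * Local o-minimality of the open core *)

Definition accum1 (X : set R) : set R :=
  [set x | forall e, zero < e -> exists y, X y /\ near e x y].

(** Definable connectedness. As [accum1] is the closure (the point itself is allowed), the last
    hypothesis says that no boundary point of [X] lies between [u] and [v]. *)
Lemma interval_clopen (X : set R) u v : dfn X -> u <= v -> X u ->
  (forall x, u <= x -> x <= v -> ~ (accum1 X x /\ accum1 (~` X) x)) -> X v.
Proof.
move=> dX uv Xu Xb.
pose Z z := [/\ u <= z, z <= v & forall y, u <= y -> y <= z -> X y].
have Zu : Z u.
  by split=> // y uy yu; rewrite (@le_anti _ _ y u) ?yu.
have [|||s [Zs slub sZ]] := @sup_ex Z v.
- by rewrite /Z; definability.
- by exists u.
- by move=> z [].
have us := Zs u Zu; have sv : s <= v by apply: slub => z [].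
have /not_andP[ns|ns] := Xb s us sv.
  have /existsNP[h /not_implyP[h0 hP]] := ns.
  have [z [[uz zv zP] zs sz]] := sZ h h0.
  by case: hP; exists z; split=> //; exact: zP.
have /existsNP[h /not_implyP[h0 hP]] := ns.
have sX y : near h s y -> X y.
  by move=> sy; apply: contrapT => nXy; apply: hP; exists y.
have [ltsv|//] := ltP s v; last first.
  move=> vs; rewrite (@le_anti _ _ v s) ?vs ?sv //.
  by apply: sX; exact: near_refl.
have [t [st tv nst]] := near_above ltsv h0.
suff /Zs : Z t by rewrite leNgt st.
have [z [[uz zv zP] zs sz]] := sZ h h0.
split; [exact: le_trans (ltW st)|exact: ltW|move=> y uy yt].
have [yz|zy] := leP y z; first exact: zP.
apply: sX; have [ys|sy] := leP y s.
  by apply: (near_between (near_sym sz)) => //; exact: ltW.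
by apply: (near_between nst) => //; exact: ltW.
Qed.

Lemma interval_clopen_oo (X : set R) p q : dfn X ->
  (forall x, p < x -> x < q -> ~ (accum1 X x /\ accum1 (~` X) x)) ->
  (forall x, p < x -> x < q -> X x) \/ (forall x, p < x -> x < q -> ~ X x).
Proof.
move=> dX Xb; apply: contrapT => /not_orP[].
move=> /existsNP[v /not_implyP[pv /not_implyP[vq nXv]]].
move=> /existsNP[u /not_implyP[pu /not_implyP[uq /contrapT Xu]]].
have [uv|/ltW vu] := leP u v.
  apply/nXv/(interval_clopen dX uv Xu) => x ux xv; apply: Xb.
    exact: lt_le_trans ux.
  exact: le_lt_trans xv _.
have dCX : dfn (~` X)%classic by exact: definable_not.
apply: (interval_clopen dCX vu nXv _ Xu) => x vx xu; rewrite setCK andC.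
apply: Xb; first exact: lt_le_trans vx.
exact: le_lt_trans xu _.
Qed.

(** By [sigma_dichotomy] the boundary of [X] is nowhere dense, hence without accumulation points.
    Near [a] only [a] itself can be a boundary point, so on each side of [a] the set [X] is
    everything or nothing. *)
Lemma open_core_locally_ominimal : locally_ominimal (open_core N).
Proof.
move=> X a dX; set A := [set x : 'rV[R]_1 | X (x ord0 ord0)].
have cA : definably_constructible A by exact: open_core_constructible.
have [sA _] := definably_constructible_sigma cA.
have {}dX : dfn X.
  apply/definable1E/(definable_onE _ zero)/(definable_sigma sA).
have dB : dfn [set x | accum1 X x /\ accum1 (~` X)%classic x].
  by rewrite /accum1 /setC /=; definability.
have dB1 : discrete1 [set x | accum1 X x /\ accum1 (~` X)%classic x].
  apply: nowhere_dense1_discrete => // p q pq.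
  have [m /andP[pm mq]] := R_dense pq; have [e e0 eP] := near_itv pm mq.
  have [z [e' [e'0 zm zA]]] := sigma_dichotomy (\row__ m)%R sA e0.
  have [pz zq] : (p < z ord0 ord0) /\ (z ord0 ord0 < q).
    by apply: eP; have := zm z (cube_refl z e'0) ord0; rewrite mxE.
  have [q' [zq' q'q nzq']] := near_above zq e'0.
  exists (z ord0 ord0), q'; split=> //; [exact: ltW|exact: ltW|].
  move=> x /= [xX xCX] zx xq'.
  have [h h0 hP] := near_itv zx xq'.
  have zy y : near h x y -> cube z e' (\row__ y)%R.
    move=> /hP[zy yq'] i; rewrite (ord1 i) mxE.
    by apply: (near_between nzq') => //; exact: ltW.
  have [y [Xy xy]] := xX h h0; have [y' [nXy' xy']] := xCX h h0.
  case: zA => zA; first by apply: nXy'; have := zA _ (zy y' xy');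
    rewrite /A /= mxE.
  by apply: (zA _ (zy y xy)); rewrite /A /= mxE.
have [h h0 hP] := dB1 a; have [l [u /andP[la au]]] := R_noends a.
have [b [_ ba nab]] := near_below la h0;
  have [c [ac _ nac]] := near_above au h0.
exists b, c; split; first by rewrite in_itv /= ba ac.
pose lX := forall x, b < x -> x < a -> X x.
pose rX := forall x, a < x -> x < c -> X x.
have lXP : lX \/ forall x, b < x -> x < a -> ~ X x.
  apply: interval_clopen_oo => // x bx xa /hP xBa; move: (xa);
    rewrite xBa ?ltxx //.
  by apply: (near_between (near_sym nab)) => //; exact: ltW.
have rXP : rX \/ forall x, a < x -> x < c -> ~ X x.
  apply: interval_clopen_oo => // x ax xc /hP xBa; move: (ax);
    rewrite xBa ?ltxx //.
  by apply: (near_between nac) => //; exact: ltW.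
(* The conditions [X a], [lX] and [rX] select which of the point and the two half-intervals
   occur. *)
exists [set x | x = a /\ X a], [set p | p = (b, a) /\ lX \/ p = (a, c) /\ rX].
split.
- by apply: (sub_finite_set _ (finite_set1 a)) => x [->].
- apply: (sub_finite_set (B := [set (b, a)] `|` [set (a, c)])%classic).
    by move=> p [[-> _]|[-> _]]; [left|right].
  by rewrite finite_setU; split; exact: finite_set1.
- apply/seteqP; split=> x.
    move=> [Xx]; rewrite /= in_itv /= => /andP[bx xc].
    have [xa|ax|xa] := ltgtP x a.
    + right; exists (b, a); last by rewrite /= in_itv /= bx.
      by left; split=> //; case: lXP => // /(_ x bx xa).
    + right; exists (a, c); last by rewrite /= in_itv /= ax.
      by right; split=> //; case: rXP => // /(_ x ax xc).
    + by left; rewrite -xa.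
  move=> [[-> Xa]|[p [[-> lp]|[-> rp]]]]; rewrite /= in_itv /=.
  + by rewrite ba ac.
  + by move=> /andP[bx xa]; rewrite in_itv /= bx (lt_trans xa ac); split=> //;
    exact: lp.
  + by move=> /andP[ax xc]; rewrite in_itv /= xc (lt_trans ba ax); split=> //;
    exact: rp.
Qed.

End Tame.

(** * From local o-minimality back to condition (1) *)

Lemma closed_definable1_open_core (X : set R) : definable1 N X -> closed X ->
  definable1 (open_core N) X.
Proof.
move=> dX cX.
pose U := (~` [set x : 'rV[R]_1 | X (x ord0 ord0)])%classic.
have oU : open U.
  apply/open_clP => x xX nXx; apply: nXx; apply: (closed_nearP X).1 => // e e0.
  have [y [xy /contrapT Xy]] := xX e e0.
  by exists (y ord0 ord0) => //; exact: xy.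
have dU : definable N U.
  by apply/(definable_onE _ zero)/definable_not/(definable_onE _ zero).
(* The complement of [X] is a unary relation symbol of the open core, and [X] is defined by its
   negation. *)
pose u : rsym (open_core_language N) :=
  existT _ 1%N (exist _ U (And3 isT oU dU)).
pose phi := FNeg (@FRel (open_core_language N) u (fun i => Var _ (val i))).
exists phi, (fun=> zero); apply/seteqP; split=> x.
  move=> Xx /=; rewrite /U /=; apply.
  by rewrite mxE (row_cat_ord x (fun=> zero) ord0).
move=> /=; rewrite /U /= => /contrapT.
by rewrite mxE (row_cat_ord x (fun=> zero) ord0).
Qed.

(** If [X] contains no nonempty interval, the intervals in its local description at [a] are all
    empty. What remains near [a] is a finite set, so [a] is isolated. *)
Lemma locally_ominimal_closed_tame :
  locally_ominimal (open_core N) -> closed_discrete_or_interval N.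
Proof.
move=> lo X dX cX; have [|nI] := pselect (exists a b : R,
  `]a, b[%classic !=set0 /\ `]a, b[%classic `<=` X); [by right|left].
move=> a Xa.
have [b [c [abc [P [J [/finite_seqP[s PE] _ XPJ]]]]]] :=
  lo X a (closed_definable1_open_core dX cX).
have [h h0 hs] : exists2 h, zero < h & forall x, x \in s -> near h a x -> x = a.
  elim: s {PE} => [|x s [h h0 hP]]; first by have [h] := pos_ex; exists h.
  have [xa|xa] := pselect (x = a).
    by exists h => // y; rewrite inE => /orP[/eqP -> //|/hP].
  have [g g0 gP] : exists2 g, zero < g & ~ near g a x.
    apply: contrapT => H; apply: xa; apply/esym/near_eq => e e0.
    by apply: contrapT => ne; apply: H; exists e.
  have [m0 mh mg] := min_pos h0 g0; exists (Order.min h g) => // y.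
  rewrite inE => /orP[/eqP -> /(near_le mg)//|/hP H /(near_le mh)]; exact: H.
split; first exact/mem_set.
exists (`]b, c[%classic `&` [set x | near h a x])%classic.
  apply: filterI; last by apply/nbhs_nearP; exists h.
  by apply: open_nbhs_nbhs; split; [exact: itv_open|exact: abc].
apply/seteqP; split=> [x [[bxc ax] Xx]|_ ->]; last first.
  by split=> //; split; [exact: abc|exact: near_refl].
have : (X `&` `]b, c[)%classic x by [].
rewrite XPJ => -[Px|[p Jp px]].
  by apply: hs ax; move: Px; rewrite PE.
case: nI; exists p.1, p.2; split; first by exists x.
move=> y py; have : (X `&` `]b, c[)%classic y by rewrite XPJ; right; exists p.
by case.
Qed.

End Definability.

End OrderedGroup.

Theorem theorem1p1 (d : Order.disp_t) (R : orderTopologicalType d)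
    (add : R -> R -> R) (zero : R) (L : language) (M : structure L R)
    (R_group : ordered_abelian_group add zero) (R_dense : dense_order R)
    (R_noends : without_endpoints R)
    (R_complete : definably_complete (ogroup_expansion add zero M)) :
  (closed_discrete_or_interval (ogroup_expansion add zero M) <->
     locally_ominimal (open_core (ogroup_expansion add zero M))) /\
  (closed_discrete_or_interval (ogroup_expansion add zero M) \/
     locally_ominimal (open_core (ogroup_expansion add zero M)) ->
   forall (n : nat) (X : set 'rV[R]_n),
     definable (open_core (ogroup_expansion add zero M)) X -> constructible X).
Proof.
have tame : locally_ominimal (open_core (ogroup_expansion add zero M)) ->
    closed_discrete_or_interval (ogroup_expansion add zero M).
  exact: locally_ominimal_closed_tame.
split; first by split=> //; exact: open_core_locally_ominimal.
move=> H n X dX; have {}H : closed_discrete_or_interval (ogroup_expansion add zero M).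
  by case: H.
apply: (@definably_constructible_constructible d R add zero L M).
exact: open_core_constructible dX.
Qed.
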